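(* There exists a constant $C>0$ such that the following holds. Let $\Phi\ge 1$ be an integer, let $K$ be the truncated Fourier operator with cutoff frequency $\Phi$, and let $u^\dagger=\sum_{m=1}^M\sum_{n=1}^N u^\dagger_{mn}\chi_{[x_m,x_{m+1}[\times[y_n,y_{n+1}[}$ be a real-valued piecewise constant image on $\Omega=(\mathbb R/\mathbb Z)^2$ which satisfies the consistent gradient direction assumption, with minimum edge distance $\Delta$. Let $f^\dagger=Ku^\dagger$. If $\Delta>\frac{C}{\Phi}$, then $u^\dagger$ is the unique minimizer over $L^2(\Omega)$ of $$J_0^{f^\dagger}(u)=\mathrm{TV}(u)+\iota_{\{f^\dagger\}}(Ku).$$
   Context: $\Omega=(\mathbb R/\mathbb Z)^2$ is the flat torus; $\mathbb R/\mathbb Z$ is identified with $[0,1[$ and $\mathrm{dist}$ is its metric. $L^2(\Omega)$ denotes real-valued functions. Truncated Fourier operator: $Ku=(\hat u_k)_{k\in\mathbb Z^2,|k|_\infty\le\Phi}$ with $\hat u_k=\int_\Omega e^{-2\pi i (x,y)\cdot(k_1,k_2)}u(x,y)\,\mathrm d(x,y)$. Image: $x_1<\dots<x_M$ and $y_1<\dots<y_N$ are points in $[0,1[$, $x_{M+1}=x_1$, $y_{N+1}=y_1$; an interval $[a,b[$ with $b<a$ is read cyclically, i.e. as $[a,1+b[$ projected onto $\mathbb R/\mathbb Z$. $\chi_A$ is the characteristic function of $A$, and $u^\dagger_{mn}\in\mathbb R$. The minimum edge distance is $\Delta=\min\{\min_{m=1,\dots,M}\mathrm{dist}(x_m,x_{m+1}),\min_{n=1,\dots,N}\mathrm{dist}(y_n,y_{n+1})\}$.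 Consistent gradient direction assumption: writing $D_x,D_y$ for distributional partial derivatives, for each $m$ the restriction of the measure $D_xu^\dagger$ to the line $\{x_m\}\times\mathbb R/\mathbb Z$ is either a nonnegative or a nonpositive measure, and for each $n$ the restriction of $D_yu^\dagger$ to $\mathbb R/\mathbb Z\times\{y_n\}$ is either a nonnegative or a nonpositive measure. Anisotropic total variation (periodic boundary conditions): $\mathrm{TV}(u)=\sup\{\int_\Omega u\,\mathrm{div}\varphi\,\mathrm d(x,y)\mid\varphi\in C^\infty(\Omega,\mathbb R^2),\ \sup_{\Omega}|\varphi|_\infty\le1\}\in[0,\infty]$. $\iota_A$ is the convex indicator function: $0$ on $A$ and $+\infty$ elsewhere. *)

(* Defs.v *)
From HB Require Import structures.
From mathcomp Require Import all_boot all_order all_algebra.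
From mathcomp Require Import all_classical all_reals all_analysis.
From mathcomp Require Import complex.

Set Implicit Arguments.
Unset Strict Implicit.
Unset Printing Implicit Defensive.

Import Order.TTheory GRing.Theory Num.Theory.
Import numFieldNormedType.Exports.

Local Open Scope classical_set_scope.
Local Open Scope ring_scope.
Local Open Scope complex_scope.
Local Open Scope charge_scope.

Section Torus.
Context {R : realType}.

(* R/Z is identified with [0,1[.  A function on the torus is given by a function
   R * R -> R of which only the values on [torus] matter; for continuous and
   smooth functions the representative is the 1-periodic one. *)
Definition torus : set (R * R) := `[0, 1[ `*` `[0, 1[.

(* R * R with the product of the Borel sigma-algebras. *)
Local Notation plane := (measurableTypeR R * measurableTypeR R)%type.

Definition leb2 : {measure set plane -> \bar R} :=
  (@lebesgue_measure R \x @lebesgue_measure R)%E.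

(* The quotient metric of R/Z. *)
Definition circle_dist (a b : R) : R := inf [set `|a - b + k%:~R| | k in [set: int]].

(* The cyclic interval [a,b[ for a, b in [0,1[; t |-> t - floor t is the
   projection of R onto R/Z = [0,1[. *)
Definition cyclic_itv (a b : R) : set R :=
  [set t - (Num.floor t)%:~R | t in `[a, if b < a then 1 + b else b[].

(* Membership in L^2(torus) of the class of u, through its extension by 0. *)
Definition L2_torus (u : R * R -> R) : Prop := u \_ torus \in Lfun leb2 2%:E.

Definition partial_x (f : R * R -> R) (p : R * R) : R := derive1 (fun s => f (s, p.2)) p.1.
Definition partial_y (f : R * R -> R) (p : R * R) : R := derive1 (fun s => f (p.1, s)) p.2.

(* All partial derivatives up to order k exist and are continuous. *)
Fixpoint Ck (k : nat) (f : R * R -> R) : Prop :=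
  continuous f /\
  if k is k'.+1 then
    [/\ forall p : R * R, derivable (fun s : R => f (s, p.2)) p.1 1,
        forall p : R * R, derivable (fun s : R => f (p.1, s)) p.2 1,
        Ck k' (partial_x f) & Ck k' (partial_y f)]
  else True.

Definition smooth_torus (f : R * R -> R) : Prop :=
  (forall k, Ck k f) /\
  forall x y, f (x + 1, y) = f (x, y) /\ f (x, y + 1) = f (x, y).

Definition divergence (phi : R * R -> R * R) (p : R * R) : R :=
  partial_x (fst \o phi) p + partial_y (snd \o phi) p.

Definition TV (u : R * R -> R) : \bar R :=
  ereal_sup [set (\int[leb2]_(p in torus) (u p * divergence phi p)%:E)%E | phi in
    [set phi : R * R -> R * R |
      [/\ smooth_torus (fst \o phi), smooth_torus (snd \o phi) &
          forall p, Num.max `|(phi p).1| `|(phi p).2| <= 1]]].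

(* Integral against a signed measure, as the difference of the integrals against
   the two parts of its Jordan decomposition; it does not depend on the Hahn
   decomposition that is chosen. *)
Definition charge_integral (nu : {charge set plane -> \bar R})
    (D : set (R * R)) (f : R * R -> R) : R :=
  let: exist P hP := cid (Hahn_decomposition nu) in
  let: exist N nuPN := cid hP in
  \int[jordan_pos nuPN]_(p in D) f p - \int[jordan_neg nuPN]_(p in D) f p.

(* nu, read on [torus], is the distributional derivative of u in the direction
   of the partial derivative d (one of partial_x, partial_y). *)
Definition is_distr_deriv (d : (R * R -> R) -> R * R -> R) (u : R * R -> R)
    (nu : {charge set plane -> \bar R}) : Prop :=
  forall phi, smooth_torus phi ->
    \int[leb2]_(p in torus) (u p * d phi p) = - charge_integral nu torus phi.

Definition signed_on (nu : {charge set plane -> \bar R}) (A : set (R * R)) : Prop :=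
  nu.-positive_set A \/ nu.-negative_set A.

(* The derivatives of u are unique as measures on [torus], and they exist for
   piecewise constant u. *)
Definition consistent_gradient_direction (M N : nat) (x : 'I_M -> R)
    (y : 'I_N -> R) (u : R * R -> R) : Prop :=
  (exists nu, is_distr_deriv partial_x u nu /\
     forall m, signed_on nu ([set x m] `*` `[0, 1[)) /\
  (exists nu, is_distr_deriv partial_y u nu /\
     forall n, signed_on nu (`[0, 1[ `*` [set y n])).

(* [ordS] is the cyclic successor on 'I_n. *)
Definition image_fun (M N : nat) (x : 'I_M -> R) (y : 'I_N -> R)
    (c : 'M[R]_(M, N)) (p : R * R) : R :=
  \sum_(m < M) \sum_(n < N)
    c m n * \1_(cyclic_itv (x m) (x (ordS m)) `*` cyclic_itv (y n) (y (ordS n))) p.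

(* The bigop starts from the term of index 0, so it is the plain minimum. *)
Definition min_gap (n : nat) (x : 'I_n.+1 -> R) : R :=
  \big[Num.min/circle_dist (x ord0) (x (ordS ord0))]_(i < n.+1)
    circle_dist (x i) (x (ordS i)).

Definition min_edge_dist (M N : nat) (x : 'I_M.+1 -> R) (y : 'I_N.+1 -> R) : R :=
  Num.min (min_gap x) (min_gap y).

Definition expi (t : R) : R[i] := cos t +i* sin t.

Definition Cintegral (D : set (R * R)) (f : R * R -> R[i]) : R[i] :=
  (\int[leb2]_(p in D) complex.Re (f p)) +i* (\int[leb2]_(p in D) complex.Im (f p)).

Definition fourier_coef (u : R * R -> R) (k : int * int) : R[i] :=
  Cintegral torus (fun p =>
    expi (- (2 * pi * (p.1 * k.1%:~R + p.2 * k.2%:~R))) * (u p)%:C).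

Definition freq (Phi : nat) : Type :=
  {k : int * int | Num.max `|k.1| `|k.2| <= Phi%:Z}.

Definition fourier_trunc (Phi : nat) (u : R * R -> R) : freq Phi -> R[i] :=
  fun k => fourier_coef u (sval k).
#[global] Arguments fourier_trunc Phi u k : clear implicits.

Definition convex_indicator (T : Type) (A : set T) (z : T) : \bar R :=
  if z \in A then 0%E else +oo%E.

Definition J0 (Phi : nat) (f : freq Phi -> R[i]) (u : R * R -> R) : \bar R :=
  (TV u + convex_indicator [set f] (fourier_trunc Phi u))%E.

Definition L2_minimizer (J : (R * R -> R) -> \bar R) (u : R * R -> R) : Prop :=
  L2_torus u /\ forall v, L2_torus v -> (J u <= J v)%E.

(* Uniqueness is in L^2, i.e. up to almost everywhere equality on the torus. *)
Definition unique_L2_minimizer (J : (R * R -> R) -> \bar R) (u : R * R -> R) : Prop :=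
  L2_minimizer J u /\
  forall v, L2_minimizer J v -> {ae leb2, forall p, torus p -> v p = u p}.

End Torus.

(* Main.v *)
(*
  Duality.  If g1 and g2 are trigonometric polynomials of degree at most Phi with
  |g1|, |g2| <= 1, and g1 (resp. g2) takes at each x_m (resp. y_n) the value 1 or
  -1 opposite to the sign of the jumps of u across that line, then
  phi0 = (g1(x), g2(y)) is admissible in TV and int u div phi0 = TV(u).  As
  div phi0 only has frequencies at most Phi, int v div phi0 = int u div phi0
  <= TV(v) whenever K v = K u.

  Construction of g.  Fejer kernels of degree about Phi / 6 centred at the nodes
  form a diagonally dominant interpolation matrix when the nodes are separated by
  more than C / Phi.  This gives an interpolant h with |h| <= 2, and
  g = (3 h - h^3) / 2 then satisfies |g| <= 1 with the same values 1 and -1.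
  Moreover 2 deg g <= Phi and |g| < 1 somewhere.

  Uniqueness.  If TV(v) = TV(u) and K v = K u, then perturbing phi0 by
  e ((1 - g1^2) q, 0) gives int v D_x((1 - g1^2) q) = 0 for all trigonometric
  polynomials q, and the same holds for u.  So the Fourier modes of v - u on each
  row of frequencies, multiplied by the frequency, satisfy a linear recurrence of
  order at most 2 Phi.  They vanish for frequencies at most Phi, hence vanish
  identically on the rows of index at most Phi.  The same argument along the
  columns, with g2, shows that all modes vanish.

  Signs of the jumps.  Testing D_x u against ((1 + cos(2 pi (x - x_m))) / 2)^k S(y)
  and letting k tend to infinity isolates the line x = x_m; letting S tend to the
  indicator of an arc inside [y_n, y_(n+1)[ isolates one edge.
*)
Require Import Defs.
From mathcomp Require Import all_boot all_order all_algebra.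
From mathcomp Require Import all_classical all_reals all_analysis measurable_realfun.
From mathcomp Require Import complex.
From mathcomp Require Import ring lra zify.

Set Implicit Arguments.
Unset Strict Implicit.
Unset Printing Implicit Defensive.

Import Order.TTheory GRing.Theory Num.Theory.
Import numFieldNormedType.Exports.

Local Open Scope classical_set_scope.
Local Open Scope ring_scope.
Local Open Scope complex_scope.
Local Open Scope charge_scope.

(** * Trigonometric polynomials and interpolation of signs *)

Section TrigPoly.
Context {R : realType}.
Implicit Types (f g : R -> R) (d : nat) (t x : R).

Lemma expiD (a b : R) : expi (a + b) = expi a * expi b.
Proof. by rewrite /expi cosD sinD; simpc; rewrite [X in _ +i* X]addrC. Qed.

Lemma expi0 : expi (0 : R) = 1.
Proof. by rewrite /expi cos0 sin0. Qed.

Lemma expiX (a : R) n : expi a ^+ n = expi (n%:R * a).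
Proof.
elim: n => [|n IH]; first by rewrite mul0r expi0.
by rewrite exprS IH -natr1 mulrDl mul1r addrC expiD.
Qed.

Definition turn t : R[i] := expi (2 * pi * t).

Lemma turnD s t : turn (s + t) = turn s * turn t.
Proof. by rewrite /turn mulrDr expiD. Qed.

(* A real trigonometric polynomial of degree at most [d]: the exponents of the
   Laurent polynomial in [turn t] are shifted by [d] to get a polynomial. *)
Definition trig_poly d f := exists P : {poly R[i]},
  (size P <= d.*2.+1)%N /\ forall t, (f t)%:C * turn t ^+ d = P.[turn t].

Lemma trig_poly_le d d' f : (d <= d')%N -> trig_poly d f -> trig_poly d' f.
Proof.
move=> dd' [P [sP fP]]; exists (P * 'X^(d' - d)); split.
  by apply: leq_trans (size_polyMleq _ _) _; rewrite size_polyXn; lia.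
move=> t; rewrite hornerM hornerXn -fP -mulrA -exprD subnKC//.
Qed.

Lemma trig_poly_const d (c : R) : trig_poly d (fun=> c).
Proof.
apply: (@trig_poly_le 0) => //; exists (c%:C%:P); split; first exact: size_polyC_leq1.
by move=> t; rewrite expr0 mulr1 hornerC.
Qed.

Lemma trig_polyD d f g : trig_poly d f -> trig_poly d g -> trig_poly d (fun t => f t + g t).
Proof.
move=> [P [sP fP]] [Q [sQ gQ]]; exists (P + Q); split.
  by apply: leq_trans (size_polyD _ _) _; rewrite geq_max sP sQ.
by move=> t; rewrite rmorphD mulrDl fP gQ hornerD.
Qed.

Lemma trig_polyM d d' f g : trig_poly d f -> trig_poly d' g ->
    trig_poly (d + d') (fun t => f t * g t).
Proof.
move=> [P [sP fP]] [Q [sQ gQ]]; exists (P * Q); split.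
  by apply: leq_trans (size_polyMleq _ _) _; lia.
by move=> t; rewrite rmorphM exprD mulrACA fP gQ hornerM.
Qed.

Lemma trig_polyZ d (c : R) f : trig_poly d f -> trig_poly d (fun t => c * f t).
Proof. by move=> lf; apply: (@trig_polyM 0) => //; exact: trig_poly_const. Qed.

Lemma trig_poly_sum (I : finType) d (F : I -> R -> R) :
  (forall i, trig_poly d (F i)) -> trig_poly d (fun t => \sum_i F i t).
Proof.
move=> lF; elim: (index_enum I) => [|i s IH].
  rewrite (_ : (fun t => _) = (fun=> 0)); first exact: trig_poly_const.
  by apply/funext => t; rewrite big_nil.
rewrite (_ : (fun t => _) = (fun t => F i t + \sum_(i <- s) F i t)); first exact: trig_polyD.
by apply/funext => t; rewrite big_cons.
Qed.

Lemma size_comp_scaleX (P : {poly R[i]}) (c : R[i]) :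
  (size (P \Po (c *: 'X)) <= size P)%N.
Proof.
have [->|P0] := eqVneq P 0; first by rewrite comp_poly0.
apply: leq_trans (size_comp_poly_leq P (c *: 'X)) _.
have sP : (0 < size P)%N by rewrite size_poly_gt0.
rewrite -[X in (_ <= X)%N](prednK sP) ltnS -[X in (_ <= X)%N]muln1 leq_mul2l; apply/orP; right.
have : (size (c *: 'X : {poly R[i]}) <= 2)%N.
  by rewrite (leq_trans (size_scale_leq _ _))// size_polyX.
by rewrite -(leq_add2r 1) => h; rewrite -ltnS; case: (size _) h => //= n; rewrite addn1.
Qed.

(** Translation composes the numerator with multiplication by [turn (- x)]; the factor [turn x ^+ d]
    corrects the exponents, which are shifted by [d]. *)
Lemma trig_poly_shift d f x : trig_poly d f -> trig_poly d (fun t => f (t - x)).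
Proof.
move=> [P [sP fP]]; exists (turn x ^+ d *: (P \Po (turn (- x) *: 'X))); split.
  exact: leq_trans (size_scale_leq _ _) (leq_trans (size_comp_scaleX _ _) sP).
move=> t; rewrite hornerZ horner_comp hornerZ hornerX -turnD addrC -fP mulrCA.
by rewrite -exprMn -turnD addrA subrr add0r.
Qed.

(** * Fejer kernels: value at 0, decay and degree *)

Definition normsq (z : R[i]) : R := complex.Re z ^+ 2 + complex.Im z ^+ 2.

Lemma normsq_ge0 z : 0 <= normsq z.
Proof. by rewrite addr_ge0// sqr_ge0. Qed.

Lemma normsqM z w : normsq (z * w) = normsq z * normsq w.
Proof. by case: z w => a b [c d]; rewrite /normsq; simpc; rewrite /=; ring. Qed.

Lemma normsqE z : (normsq z)%:C = z * z^*%C.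
Proof. by case: z => a b; rewrite /normsq; simpc; rewrite /=; congr (_ +i* _); ring. Qed.

Lemma normsq_norm z (r : R) : 0 <= r -> `|z| <= r%:C -> normsq z <= r ^+ 2.
Proof.
move=> r0 zr; rewrite -lecR normsqE -[X in _ <= X]/(real_complex R (r ^+ 2)) rmorphXn/=.
rewrite -sqr_normc; apply: lerXn2r => //; rewrite nnegrE// lecR//.
Qed.

Lemma norm_expi (a : R) : `|expi a| = 1.
Proof. by rewrite normc_def /= cos2Dsin2 sqrtr1. Qed.

Lemma normsq_turn1 t : normsq (turn t - 1) = 4 * sin (pi * t) ^+ 2.
Proof.
rewrite /normsq /turn /expi /= oppr0 addr0.
rewrite (_ : 2 * pi * t = (pi * t) *+ 2); last by rewrite -mulrA mulr_natl.
rewrite cos_mulr2n sin_mulr2n.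
have := cos2Dsin2 (pi * t); move: (cos _) (sin _) => c s h.
have -> : c ^+ 2 = 1 - s ^+ 2 by rewrite -h addrK.
rewrite -[(c * s) *+ 2]mulr_natl exprMn exprMn.
have -> : c ^+ 2 = 1 - s ^+ 2 by rewrite -h addrK.
by ring.
Qed.

Definition geom_turn (L : nat) t : R[i] := \sum_(j < L) turn t ^+ j.

(** The Fejer kernel normalised to the value 1 at 0: away from the integers it equals (sin (pi L t)
    / (L sin (pi t)))^2. *)
Definition fejer (L : nat) t : R := normsq (geom_turn L t) / L%:R ^+ 2.

Lemma fejer_ge0 L t : 0 <= fejer L t.
Proof. by rewrite /fejer divr_ge0 ?normsq_ge0// sqr_ge0. Qed.

Lemma fejer0 L : (0 < L)%N -> fejer L 0 = 1.
Proof.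
move=> L0; rewrite /fejer /geom_turn /turn mulr0 expi0.
rewrite (eq_bigr (fun=> 1)); last by move=> i _; rewrite expr1n.
rewrite sumr_const card_ord -[X in normsq X]/(L%:R : R[i]).
have -> : (L%:R : R[i]) = (L%:R)%:C by rewrite -[RHS]/(real_complex R _) rmorph_nat.
rewrite /normsq /= expr0n /= addr0 divff// sqrf_eq0 pnatr_eq0; lia.
Qed.

Lemma fejer_le1 L t : (0 < L)%N -> fejer L t <= 1.
Proof.
move=> L0; rewrite /fejer ler_pdivrMr ?exprn_gt0 ?ltr0n// mul1r.
apply: normsq_norm => //; rewrite /geom_turn.
apply: le_trans (ler_norm_sum _ _ _) _.
rewrite (eq_bigr (fun=> 1)); last by move=> i _; rewrite normrX /turn norm_expi expr1n.
rewrite sumr_const card_ord -[X in X <= _]/(L%:R : R[i]).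
by rewrite -[X in _ <= X]/(real_complex R _) rmorph_nat.
Qed.

(** The geometric sum telescopes: multiplied by [turn t - 1] it becomes [turn t ^+ L - 1], of
    modulus at most 2, while [turn t - 1] has modulus 2 |sin (pi t)|. The product form avoids a
    division at the zeros of the sine. *)
Lemma fejer_decay L t : fejer L t * (L%:R * sin (pi * t)) ^+ 2 <= 1.
Proof.
case: L => [|L]; first by rewrite mul0r expr0n mulr0 ler01.
have L0 : (L.+1%:R : R) ^+ 2 != 0 by rewrite sqrf_eq0 pnatr_eq0.
have h : normsq (geom_turn L.+1 t) * (4 * sin (pi * t) ^+ 2) <= 2 ^+ 2.
  rewrite -normsq_turn1 -normsqM mulrC /geom_turn -subrX1 /turn expiX.
  apply: normsq_norm => //; apply: le_trans (ler_normB _ _) _.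
  rewrite norm_expi normr1.
  by rewrite -[X in _ <= X]/(real_complex R 2%:R) rmorph_nat.
rewrite /fejer exprMn mulrA divfK//.
by move: h; nra.
Qed.

Lemma conjc_turn t : (turn t)^*%C = turn (- t).
Proof. by rewrite /turn mulrN /expi cosN sinN. Qed.

Lemma conjc_turnX t n : ((turn t ^+ n)^*)%C = turn (- t) ^+ n.
Proof. by rewrite /turn !expiX mulrN mulrN /expi cosN sinN. Qed.

(** On the unit circle the conjugate of [geom_turn d.+1 t], multiplied by [turn t ^+ d], is the same
    sum read backwards. Hence the squared modulus times [turn t ^+ d] is the square of a polynomial
    of degree [d]. *)
Lemma trig_poly_fejer d : trig_poly d (fejer d.+1).
Proof.
exists ((d.+1%:R ^- 2)%:C *: (\sum_(j < d.+1) 'X^j) ^+ 2); split.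
  apply: leq_trans (size_scale_leq _ _) _.
  rewrite expr2; apply: leq_trans (size_polyMleq _ _) _.
  have : (size (\sum_(j < d.+1) 'X^j : {poly R[i]})%R <= d.+1)%N.
    apply: leq_trans (size_sum _ _ _) _; apply/bigmax_leqP => i _.
    by rewrite size_polyXn.
  have aux a : (a <= d.+1 -> (a + a).-1 <= d.*2.+1)%N by lia.
  exact: aux.
move=> t; rewrite hornerZ horner_exp horner_sum.
rewrite (eq_bigr (fun j : 'I_d.+1 => turn t ^+ j)); last by move=> i _; rewrite hornerXn.
rewrite -/(geom_turn d.+1 t) /fejer mulrC -[(_ / _)%:C]/(real_complex R _) rmorphM/=.
rewrite [(_ ^- 2)%:C]/(real_complex R _) [X in _ * X]mulrC mulrCA; congr (_ * _).
rewrite normsqE mulrCA expr2; congr (_ * _).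
rewrite /geom_turn -[(_^*)%C]/(conjc _) rmorph_sum /= mulr_sumr (reindex_inj rev_ord_inj) /=.
apply: eq_bigr => j _; rewrite conjc_turnX subSS.
rewrite (_ : turn t ^+ d = turn t ^+ j * turn t ^+ (d - j)); last by rewrite -exprD subnKC ?leq_ord.
rewrite -mulrA -exprMn -turnD subrr /turn mulr0 expi0 expr1n mulr1.
by [].
Qed.

(** By symmetry it suffices to treat t <= 1/2. There sin (pi t) = 2 sin (pi t / 2) cos (pi t / 2),
    and the mean value theorem turns the sine into cos c * (pi t / 2). Both cosines are at least cos
    (pi / 4), so their product is at least 1/2, and pi >= 2 concludes. *)
Lemma sin_ge_min t : 0 <= t <= 1 -> Num.min t (1 - t) <= sin (pi * t).
Proof.
suff H : forall t, 0 <= t <= 1 / 2 -> t <= sin (pi * t).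
  move=> /andP[t0 t1]; have [h|h] := leP t (1 / 2).
    by rewrite ge_min H ?t0.
  rewrite ge_min; apply/orP; right.
  rewrite (_ : sin (pi * t) = sin (pi * (1 - t))); first by apply: H; lra.
  by rewrite mulrBr mulr1 sinB cospi sinpi mul0r sub0r mulN1r opprK.
move=> {}t /andP[t0 t2].
have pi0 := pi_gt0 R.
have := @MVT_segment R sin cos 0 (pi * t / 2).
have h0 : 0 <= pi * t / 2 by nra.
move=> /(_ h0) [] //.
  by move=> z; apply: continuous_subspaceT => ?; exact: continuous_sin.
move=> c; rewrite in_itv /= => /andP[c0 c1]; rewrite sin0 !subr0 => sE.
have c4 : cos (pi / 4 : R) ^+ 2 = 1 / 2.
  have := cos_mulr2n (pi / 4 : R).
  rewrite (_ : (pi / 4 : R) *+ 2 = pi / 2) ?cos_pihalf; last by rewrite mulr2n; field.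
  by rewrite mulr2n; lra.
have cmono a b : 0 <= a -> a <= b -> b <= pi / 4 -> cos b <= cos a :> R.
  move=> a0 ab b4; rewrite le_eqVlt; have [->|ne] := eqVneq a b; first by rewrite eqxx.
  by rewrite ltr_cos ?in_itv /= ?lt_neqAle ?ne ?ab ?orbT//; lra.
have cp4 : 0 <= cos (pi / 4 : R) by apply: cos_ge0_pihalf; lra.
have k1 : cos (pi / 4) <= cos c by apply: cmono => //; nra.
have k2 : cos (pi / 4) <= cos (pi * t / 2) by apply: cmono => //; nra.
have pi2 := pi_ge2 R.
rewrite (_ : pi * t = (pi * t / 2) *+ 2); last by lra.
rewrite sin_mulr2n sE -mulr_natl.
have : 1 / 2 <= cos (pi * t / 2) * cos c.
  rewrite -c4 expr2; exact: ler_pM.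
move: (cos _) (cos _) => u v uv.
rewrite (_ : 2 * (v * (u * (pi * t / 2))) = (v * u) * (pi * t)); last by field.
have : 2 * t <= pi * t by nra.
move=> h; have {}h : t <= 1 / 2 * (pi * t) by lra.
apply: le_trans h _.
by apply: ler_wpM2r => //; rewrite mulr_ge0// ltW.
Qed.

(* The interpolation matrix is strictly diagonally dominant. *)
Lemma dominant_interpolation n (F : R -> R) (z s : 'I_n.+1 -> R) (eta : R) : eta < 1 ->
  (forall t, 0 <= F t) -> F 0 = 1 ->
  (forall i, \sum_(j < n.+1 | j != i) F (z i - z j) <= eta) ->
  (forall i, `|s i| <= 1) ->
  exists a : 'I_n.+1 -> R, (forall i, \sum_j a j * F (z i - z j) = s i) /\
    forall j, `|a j| <= (1 - eta)^-1.
Proof.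
move=> eta1 F0 F1 Fs s1.
(* At an index where [a] is largest in absolute value, the other terms can cancel at most the
   fraction [eta] of the diagonal one. This yields first the invertibility of the matrix, then the
   bound on the coefficients. *)
have dom (a : 'I_n.+1 -> R) i : (forall j, `|a j| <= `|a i|) ->
    (1 - eta) * `|a i| <= `|\sum_j a j * F (z i - z j)|.
  move=> ai; rewrite (bigD1 i) //= subrr F1 mulr1.
  have h : `|\sum_(j < n.+1 | j != i) a j * F (z i - z j)| <= eta * `|a i|.
    apply: le_trans (ler_norm_sum _ _ _) _.
    apply: (@le_trans _ _ (\sum_(j < n.+1 | j != i) F (z i - z j) * `|a i|)).
      apply: ler_sum => j _; rewrite normrM (ger0_norm (F0 _)) mulrC.
      by rewrite ler_wpM2l.
    by rewrite -mulr_suml ler_wpM2r.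
  have := lerB_normD (a i) (\sum_(j < n.+1 | j != i) a j * F (z i - z j)).
  by move: h; lra.
have argm (a : 'I_n.+1 -> R) : exists i, forall j, `|a j| <= `|a i|.
  exists [arg max_(i > ord0) `|a i|]%O.
  by case: Order.TotalTheory.arg_maxP => // i _ h j; exact: h.
pose A : 'M[R]_n.+1 := \matrix_(j, i) F (z i - z j).
have uA : A \in unitmx.
  rewrite -row_free_unit; apply/row_freeP.
  suff : kermx A == 0 by rewrite kermx_eq0 => /row_freeP.
  apply/eqP/row_matrixP => k; rewrite row0; set v := row k _.
  have vA : v *m A = 0 by rewrite -row_mul mulmx_ker row0.
  have [i hi] := argm (fun j => v 0 j).
  have := dom _ _ hi.
  rewrite (_ : \sum_j _ = (v *m A) 0 i); last first.
    by rewrite [RHS]mxE; apply: eq_bigr => j _; congr (_ * _); rewrite mxE.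
  rewrite (_ : (v *m A) 0 i = 0); last by rewrite vA mxE.
  rewrite normr0 pmulr_rle0 ?subr_gt0// => vi.
  apply/rowP => j; rewrite [RHS]mxE; apply: normr0_eq0; apply/eqP; rewrite eq_le normr_ge0 andbT.
  exact: le_trans (hi j) vi.
pose w := (\row_i s i) *m invmx A.
have wE i : \sum_j w 0 j * F (z i - z j) = s i.
  have : (w *m A) 0 i = s i by rewrite mulmxKV// mxE.
  by move=> <-; rewrite [RHS]mxE; apply: eq_bigr => j _; congr (_ * _); rewrite mxE.
exists (fun j => w 0 j); split => // j.
have [i hi] := argm (fun j => w 0 j).
apply: le_trans (hi j) _.
have := dom _ _ hi; rewrite wE => h; have := le_trans h (s1 i).
by rewrite mulrC -ler_pdivlMr ?subr_gt0// mul1r.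
Qed.

(** The stronger bound 2 - 1/(n+1) on the sum of the first n+1 terms passes through the
    induction. *)
Lemma sum_inv_sq n : \sum_(0 <= k < n) (k.+1%:R ^- 2 : R) <= 2.
Proof.
case: n => [|n]; first by rewrite big_geq.
apply: (@le_trans _ _ (2 - n.+1%:R^-1)); last by rewrite gerBl.
elim: n => [|n IH]; first by rewrite big_nat1 expr1n invr1; lra.
rewrite big_nat_recr //=; apply: le_trans (lerD IH (lexx _)) _.
rewrite -[n.+2%:R]natr1.
have : 0 < n.+1%:R :> R by [].
move: (n.+1%:R) => p p0.
rewrite -subr_ge0 (_ : _ - _ = (p * (p + 1) ^+ 2)^-1); last first.
  by field; apply/andP; split; apply: lt0r_neq0; lra.
by rewrite invr_ge0 mulr_ge0 ?sqr_ge0 ?ltW.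
Qed.

(** Each positive index distance occurs at most twice, once on either side of [i]. *)
Lemma sum_dist n (i : 'I_n.+1) (f : nat -> R) : (forall k, 0 <= f k) ->
  \sum_(j < n.+1 | j != i) f (if (j < i)%N then i - j else j - i)%N
    <= 2 * \sum_(0 <= k < n) f k.+1.
Proof.
move=> f0.
have mono a b : (a <= b)%N -> \sum_(0 <= k < a) f k.+1 <= \sum_(0 <= k < b) f k.+1.
  by move=> ab; rewrite [X in _ <= X](@big_cat_nat _ _ _ a)//= lerDl sumr_ge0.
pose h (j : nat) := f (if (j < i)%N then i - j else j - i)%N.
rewrite (eq_bigl (fun j : 'I_n.+1 => (j : nat) != i)); last by move=> j.
rewrite -(big_mkord (fun j => j != i :> nat) h) (@big_cat_nat _ _ _ i)//=; last exact: ltnW.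
rewrite mulr_natl mulr2n lerD//.
  apply: le_trans (mono i n (leq_ord i)).
  rewrite big_nat_rev /= big_nat_cond [X in _ <= X]big_nat_cond.
  rewrite [X in _ <= X](eq_bigl (fun k => (0 <= k < i)%N)); last by move=> k; rewrite andbT.
  rewrite (eq_bigl (fun k => (0 <= k < i)%N)); last by move=> k /=; lia.
  apply: ler_sum => k ki; rewrite /h add0n.
  rewrite (_ : (i - k.+1 < i)%N = true); last by lia.
  by rewrite (_ : (i - (i - k.+1))%N = k.+1)//; lia.
have ilt := ltn_ord i.
rewrite big_ltn_cond //= eqxx /=.
apply: le_trans (mono (n - i)%N n (leq_subr _ _)).
rewrite -{1}(add0n i.+1) big_addn subSS.
rewrite big_nat_cond [X in _ <= X]big_nat_cond.
rewrite [X in _ <= X](eq_bigl (fun k => (0 <= k < n - i)%N)); last by move=> k; rewrite andbT.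
rewrite (eq_bigl (fun k => (0 <= k < n - i)%N)); last by move=> k /=; lia.
apply: ler_sum => k ki; rewrite /h.
rewrite (_ : (k + i.+1 < i)%N = false); last by lia.
by rewrite (_ : (k + i.+1 - i)%N = k.+1)//; lia.
Qed.

Lemma circle_dist_le (a b : R) (k : int) : circle_dist a b <= `|a - b + k%:~R|.
Proof.
apply: inf_lbound; last by exists k.
by exists 0 => _ [m _ <-].
Qed.

Lemma min_gap_le n (x : 'I_n.+1 -> R) i : min_gap x <= circle_dist (x i) (x (ordS i)).
Proof. by rewrite /min_gap (bigD1 i) //= ge_min lexx. Qed.

(** Half the length of the chord between two points of the unit circle that are [s] turns apart: a
    periodic and subadditive substitute for the distance on the circle. *)
Definition chord (s : R) : R := `|sin (pi * s)|.

Lemma inv_sq_half (r r' : R) : 0 < r -> r <= 2 * r' -> r' ^- 2 <= 4 * r ^- 2.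
Proof.
move=> r0 rr; have r'0 : 0 < r' by lra.
rewrite (_ : 4 * r ^- 2 = ((r / 2) ^+ 2)^-1); last by field; exact: lt0r_neq0.
rewrite lef_pV2 ?posrE ?exprn_gt0 ?divr_gt0//.
by rewrite ler_pXn2r ?nnegrE//; lra.
Qed.

(** * Nodes on the circle with cyclic gaps larger than [delta] *)

Section Nodes.
Variables (n : nat) (x : 'I_n.+1 -> R) (delta : R).
Hypothesis x01 : forall m, 0 <= x m < 1.
Hypothesis xinc : forall m m' : 'I_n.+1, (m < m')%N -> x m < x m'.
Hypothesis dx : delta < min_gap x.
Hypothesis d0 : 0 < delta.

(** A single node would be its own cyclic successor, at distance 0. *)
Lemma gap_n0 : (0 < n)%N.
Proof.
case: n x dx => // x' /lt_le_trans /(_ (min_gap_le x' ord0)).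
move=> /lt_le_trans /(_ (circle_dist_le _ _ 0)).
rewrite (_ : ordS ord0 = ord0); last by apply/val_inj.
by rewrite subrr addr0 normr0; by rewrite ltNge ltW.
Qed.

Lemma gap_succ (i j : 'I_n.+1) : (j = i.+1 :> nat) -> delta <= x j - x i.
Proof.
move=> ji; have := lt_le_trans dx (min_gap_le x i).
have -> : ordS i = j by apply/val_inj => /=; rewrite -ji modn_small.
move=> /lt_le_trans /(_ (circle_dist_le _ _ 0)); rewrite addr0.
have : x i < x j by apply: xinc; rewrite ji.
by move=> xij; rewrite distrC gtr0_norm ?subr_gt0//; exact: ltW.
Qed.

Lemma gap_wrap : delta <= 1 - (x ord_max - x ord0).
Proof.
have := lt_le_trans dx (min_gap_le x ord_max).
have -> : ordS (ord_max : 'I_n.+1) = ord0 by apply/val_inj => /=; rewrite modnn.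
(* The successor of the last node is the first node one turn further, hence the integer -1. *)
move=> /lt_le_trans /(_ (circle_dist_le _ _ (-1))).
rewrite rmorphN1; have := x01 ord0; have := x01 ord_max => /andP[? ?] /andP[? ?].
by rewrite ler0_norm; lra.
Qed.

Lemma gap_linear (i j : 'I_n.+1) : (i <= j)%N -> (j - i)%:R * delta <= x j - x i.
Proof.
case: i j => i hi [j hj] /=; elim: j hj => [|j IH] hj.
  by rewrite leqn0 => /eqP i0; subst i; rewrite (bool_irrelevance hi hj) subrr mul0r.
rewrite leq_eqVlt => /orP[/eqP ij|ij].
  by subst i; rewrite (bool_irrelevance hi hj) subnn subrr mul0r.
have hj' : (j < n.+1)%N by lia.
have := IH hj' ij; have := @gap_succ (Ordinal hj') (Ordinal hj) erefl.
rewrite subSn// -natr1 mulrDl mul1r; lra.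
Qed.

(** The arc that leads from [x j] through 1 back to [x i] crosses all the remaining gaps. *)
Lemma gap_linear_wrap (i j : 'I_n.+1) : (i <= j)%N ->
  (n.+1 - (j - i))%:R * delta <= 1 - (x j - x i).
Proof.
move=> ij; have := @gap_linear ord0 i (leq0n _); have := @gap_linear j ord_max (leq_ord _).
have := gap_wrap; rewrite /= subn0 natrB ?leq_ord// natrB ?(leq_trans (leq_subr _ _) (ltnW
    (ltn_ord j)))//.
rewrite natrB// -natr1; lra.
Qed.

Lemma chordD a b : chord (a + b) <= chord a + chord b.
Proof.
rewrite /chord mulrDr sinD; apply: le_trans (ler_normD _ _) _; rewrite !normrM.
apply: lerD; first by rewrite ler_piMr// cos_max.
by rewrite ler_piMl// cos_max.
Qed.

Lemma chordN a : chord (- a) = chord a.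
Proof. by rewrite /chord mulrN sinN normrN. Qed.

Lemma chord_ge s : 0 <= s <= 1 -> Num.min s (1 - s) <= chord s.
Proof. by move=> /sin_ge_min h; apply: le_trans h (ler_norm _). Qed.

(** One term for each way round the circle. The sum dominates the term of the shorter arc, so no
    case distinction survives in later summations. *)
Definition sep_bound k : R := k%:R ^- 2 + (n.+1 - k)%:R ^- 2.

(** The two arcs between the nodes consist of [k] and [n.+1 - k] gaps, and the chord is at least the
    length of the shorter arc by [chord_ge]. The chord is even, so [i < j] may be assumed. *)
Lemma node_sep (i j : 'I_n.+1) : j != i ->
  let k := (if (j < i)%N then i - j else j - i)%N in
  delta <= chord (x i - x j) /\ (chord (x i - x j)) ^- 2 <= delta ^- 2 * sep_bound k.
Proof.
wlog ij : i j / (i < j)%N => [hw|].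
  move=> ne; have [lt|gt|e] := ltngtP i j.
  - by have := hw _ _ lt ne; rewrite /= ltnNge ltnW.
  - have := hw _ _ gt; rewrite eq_sym => /(_ ne) /=.
    by rewrite [(i < j)%N]ltnNge (ltnW gt)/= -opprB chordN.
  - by rewrite (val_inj e) eqxx in ne.
move=> _; rewrite ltnNge ltnW//=.
have k1 : (1 <= j - i)%N by rewrite subn_gt0.
have k2 : (1 <= n.+1 - (j - i))%N by have := ltn_ord j; lia.
have a := gap_linear (ltnW ij); have b := gap_linear_wrap (ltnW ij).
rewrite -opprB chordN.
rewrite /sep_bound; move: k1 k2 a b; move: (j - i)%N (n.+1 - (j - i))%N => k l k1 k2 a b.
move: a b; move: (x j - x i) => s a b.
have kR : 1 <= k%:R :> R by rewrite ler1n.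
have lR : 1 <= l%:R :> R by rewrite ler1n.
have ka : delta <= k%:R * delta by rewrite ler_peMl// ltW.
have la : delta <= l%:R * delta by rewrite ler_peMl// ltW.
have s01 : 0 <= s <= 1.
  rewrite (le_trans (ltW d0) (le_trans ka a)) -subr_ge0.
  exact: le_trans (ltW d0) (le_trans la b).
have := chord_ge s01; move: (chord s) => r.
have inv y : 1 <= y -> y * delta <= r -> r ^- 2 <= delta ^- 2 * y ^- 2.
  move=> y1 yr; have yp : 0 < y by lra.
  have ydp : 0 < y * delta by rewrite mulr_gt0.
  have rp : 0 < r by lra.
  rewrite -invfM -exprMn lef_pV2 ?posrE ?exprn_gt0// 1?mulrC//.
  by rewrite ler_pXn2r// nnegrE ltW// mulrC.
have p0 (y : R) : 0 <= delta ^- 2 * y ^- 2.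
  by rewrite mulr_ge0// invr_ge0 sqr_ge0.
rewrite mulrDr ge_min => /orP[h|h]; split.
- exact: le_trans ka (le_trans a h).
- by apply: le_trans (inv _ kR (le_trans a h)) _; rewrite lerDl.
- exact: le_trans la (le_trans b h).
- by apply: le_trans (inv _ lR (le_trans b h)) _; rewrite lerDr.
Qed.

Lemma fejer_le L t : (0 < L)%N -> 0 < chord t -> fejer L t <= L%:R ^- 2 * (chord t) ^- 2.
Proof.
move=> L0 r0; have := fejer_decay L t.
rewrite -[X in _ * X]ger0_norm ?sqr_ge0// normrX normrM -/(chord t) => h.
have Lp : 0 < `|L%:R : R| by rewrite normr_gt0 pnatr_eq0; lia.
rewrite -ler_pdivlMr ?exprn_gt0 ?mulr_gt0// in h.
by rewrite (le_trans h)// div1r exprMn invfM normr_nat.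
Qed.

Lemma sum_node_sep L (i : 'I_n.+1) : (0 < L)%N ->
  \sum_(j < n.+1 | j != i) (L%:R ^- 2 * (chord (x i - x j)) ^- 2) <= 8 / (L%:R * delta) ^+ 2.
Proof.
move=> L0; apply: (@le_trans _ _ (\sum_(j < n.+1 | j != i)
  (L%:R ^- 2 * (delta ^- 2 * sep_bound (if (j < i)%N then i - j else j - i)%N)))).
  apply: ler_sum => j ji; apply: ler_wpM2l; first by rewrite invr_ge0 sqr_ge0.
  by have [_] := node_sep ji.
rewrite -mulr_sumr -mulr_sumr mulrA.
rewrite (_ : 8 / _ = L%:R ^- 2 * delta ^- 2 * 8); last by rewrite exprMn invfM mulrC.
apply: ler_wpM2l; first by rewrite mulr_ge0// invr_ge0 sqr_ge0.
have q0 k : 0 <= sep_bound k by rewrite addr_ge0// invr_ge0 sqr_ge0.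
apply: le_trans (sum_dist i q0) _.
(* The outer 2 is the factor of [sum_dist]; each inner 2 bounds a sum of inverse squares, the second
   one after reversal of the index. *)
rewrite (_ : 8 = 2 * (2 + 2)); last by ring.
rewrite ler_pM2l// big_split /= lerD ?sum_inv_sq//.
rewrite big_nat_rev /= add0n; apply: le_trans (sum_inv_sq n).
rewrite big_nat_cond [X in _ <= X]big_nat_cond; apply: ler_sum => k /andP[/andP[_ kn] _].
by rewrite (_ : (n.+1 - (n - k.+1).+1)%N = k.+1)//; lia.
Qed.

(* With [x i] a node nearest to [t], [chord (x i - x j) <= 2 * chord (t - x j)], so
   the sum over the other nodes is controlled by the one at the node [x i]. *)
Lemma sum_fejer_nodes L t (i : 'I_n.+1) : (0 < L)%N ->
  (forall j, chord (t - x i) <= chord (t - x j)) ->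
  \sum_(j < n.+1 | j != i) fejer L (t - x j) <= 32 / (L%:R * delta) ^+ 2.
Proof.
move=> L0 ti; apply: (@le_trans _ _ (\sum_(j < n.+1 | j != i)
   4 * (L%:R ^- 2 * (chord (x i - x j)) ^- 2))); last first.
  rewrite -mulr_sumr (_ : 32 = 4 * 8 :> R); last by ring.
  by rewrite -mulrA ler_pM2l// sum_node_sep.
apply: ler_sum => j ji.
have [sep _] := node_sep ji.
have tri : chord (x i - x j) <= chord (t - x j) + chord (t - x i).
  rewrite -[chord (t - x i)]chordN opprB (_ : x i - x j = (t - x j) + (x i - t)); last by ring.
  exact: chordD.
have := ti j => tij.
have rj : chord (x i - x j) <= 2 * chord (t - x j) by lra.
have rp := lt_le_trans d0 sep.
have rp' : 0 < chord (t - x j).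
  by move: rj rp; move: (chord _) (chord _) => A B; lra.
apply: le_trans (fejer_le L0 rp') _.
rewrite mulrCA; apply: ler_wpM2l; first by rewrite invr_ge0 sqr_ge0.
exact: inv_sq_half.
Qed.

(** Since 32 / 24^2 = 1/18 < 1/10, the interpolation matrix is dominant with [eta] = 1/10 and the
    coefficients are at most 10/9. At any point the nearest node contributes at most 1 and all the
    others at most 1/18 to the sum of kernels, which keeps [h] below 2. *)
Lemma fejer_interpolation L (s : 'I_n.+1 -> R) : 24 <= L%:R * delta -> (0 < L)%N ->
  (forall i, `|s i| <= 1) ->
  exists h, [/\ trig_poly L.-1 h, forall i, h (x i) = s i, forall t, `|h t| <= 2 &
    exists t, `|h t| < 1].
Proof.
move=> Ld L0 s1.
have Ld2 : (L%:R * delta) ^- 2 <= 1 / 576.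
  have P0 : L%:R * delta != 0 by apply: lt0r_neq0; lra.
  have : (L%:R * delta) ^- 2 * (L%:R * delta) ^+ 2 = 1 by rewrite mulVf// sqrf_eq0.
  have D0 : 0 <= (L%:R * delta) ^- 2 by rewrite invr_ge0 sqr_ge0.
  have : 576 <= (L%:R * delta) ^+ 2 by move: Ld; move: (L%:R * delta) => P Ld; nra.
  by move: D0; move: ((L%:R * delta) ^- 2) ((L%:R * delta) ^+ 2) => D P; nra.
have c9 : (1 - 1 / 10)^-1 = 10 / 9 :> R by field.
have near t : exists i, forall j, chord (t - x i) <= chord (t - x j).
  exists [arg min_(i < ord0) chord (t - x i)]%O.
  by case: Order.TotalTheory.arg_minP => // i _ h j; exact: h.
have := @dominant_interpolation n (fejer L) x s (1/10).
case=> //; first by lra.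
- by move=> t; exact: fejer_ge0.
- exact: fejer0.
- move=> i; have := @sum_fejer_nodes L (x i) i L0.
  move=> /(_ _) h; apply: le_trans (h _) _; last by lra.
  by move=> j; rewrite subrr {1}/chord mulr0 sin0 normr0 normr_ge0.
move=> a [ha a1].
exists (fun t => \sum_j a j * fejer L (t - x j)); split => //.
- apply: trig_poly_sum => j; apply: trig_polyZ; apply: (@trig_poly_shift L.-1 (fejer L)).
  by rewrite -{2}(prednK L0); exact: trig_poly_fejer.
- move=> t; have [i ti] := near t.
  have := sum_fejer_nodes L0 ti => h.
  apply: le_trans (ler_norm_sum _ _ _) _.
  apply: (@le_trans _ _ (\sum_j (1 - 1 / 10)^-1 * fejer L (t - x j))).
    apply: ler_sum => j _; rewrite normrM (ger0_norm (fejer_ge0 _ _)).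
    by apply: ler_wpM2r => //; exact: fejer_ge0.
  rewrite c9 -mulr_sumr (bigD1 i)//=; have := fejer_le1 (t - x i) L0; move: h Ld2.
  move: (\sum_(j < n.+1 | _) _) (fejer _ _) ((L%:R * delta) ^- 2) => A B D; lra.
- have n0 := gap_n0.
  have [i1 i1E] : exists o : 'I_n.+1, nat_of_ord o = 1%N by exists (Ordinal (n0 : (1 < n.+1)%N)).
  (* Halfway between the first two nodes, every node is at chord at least [delta / 2]. There even
     the nearest kernel is at most 4 / 24^2, so the whole sum is far below 1. *)
  have [t tE] : exists t, t = (x ord0 + x i1) / 2 by eexists.
  have g01 : delta <= x i1 - x ord0 by apply: gap_succ; rewrite i1E.
  have rj0 : delta / 2 <= chord (t - x ord0).
    have := x01 i1; have := x01 ord0; move: g01; rewrite tE.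
    move: (x ord0) (x i1) => a0 b0 h /andP[h1 h2] /andP[h3 h4].
    have dd : (0 : R) < delta by exact: d0.
    apply: le_trans (chord_ge _); first by rewrite le_min; apply/andP; split; lra.
    by apply/andP; split; lra.
  have rj j : delta / 2 <= chord (t - x j).
    have [->//|j0] := eqVneq j ord0.
    have oj : x i1 <= x j.
      have /gap_linear : (i1 <= j)%N by rewrite i1E lt0n; apply: contra j0 => /eqP e;
          apply/eqP/val_inj.
      by move=> h; rewrite -subr_ge0; apply: le_trans h; rewrite mulr_ge0// ltW.
    have jm : x j <= x ord_max.
      have := @gap_linear j ord_max (leq_ord _) => h.
      by rewrite -subr_ge0; apply: le_trans h; rewrite mulr_ge0// ltW.
    have := gap_wrap; rewrite -chordN opprB; move: g01 oj jm; rewrite tE.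
    move: (x ord0) (x i1) (x j) (x ord_max) => a0 b0 c0 e0 h1 h2 h3 h4.
    have dd : (0 : R) < delta by exact: d0.
    apply: le_trans (chord_ge _); first by rewrite le_min; apply/andP; split; lra.
    by apply/andP; split; lra.
  exists t; have [i ti] := near t; have := sum_fejer_nodes L0 ti => h.
  have rp : 0 < chord (t - x i).
    by apply: lt_le_trans (rj i); apply: divr_gt0.
  have fi : fejer L (t - x i) <= 4 * (L%:R * delta) ^- 2.
    apply: le_trans (fejer_le L0 rp) _.
    rewrite (_ : 4 * _ = L%:R ^- 2 * (4 * delta ^- 2)); last by rewrite exprMn invfM mulrCA.
    apply: ler_wpM2l; first by rewrite invr_ge0 sqr_ge0.
    apply: inv_sq_half; first exact: d0.
    by have := rj i; rewrite ler_pdivrMr// mulrC.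
  apply: le_lt_trans (ler_norm_sum _ _ _) _.
  apply: (@le_lt_trans _ _ (\sum_j (1 - 1 / 10)^-1 * fejer L (t - x j))).
    apply: ler_sum => j _; rewrite normrM (ger0_norm (fejer_ge0 _ _)).
    by apply: ler_wpM2r => //; exact: fejer_ge0.
  rewrite c9 -mulr_sumr (bigD1 i)//=; move: h fi Ld2.
  move: (\sum_(j < n.+1 | _) _) (fejer _ _) ((L%:R * delta) ^- 2) => A B D; lra.
Qed.

End Nodes.

(** The constant is 144 = 6 * 24: kernels of length [Phi %/ 6 + 1] meet the bound 24 of
    [fejer_interpolation], and the cubic polynomial triples their degree [Phi %/ 6]. The room left
    in [d.*2 <= Phi] is for 1 - g^2, which the point with |g| < 1 makes nonzero. *)
Lemma certificate Phi n (x s : 'I_n.+1 -> R) : (0 < Phi)%N ->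
  (forall m, 0 <= x m < 1) ->
  (forall m m' : 'I_n.+1, (m < m')%N -> x m < x m') ->
  144 / Phi%:R < min_gap x ->
  (forall i, s i ^+ 2 = 1) ->
  exists g, [/\ exists2 d, trig_poly d g & (d.*2 <= Phi)%N, forall t, `|g t| <= 1,
    forall i, g (x i) = s i & exists t, `|g t| < 1].
Proof.
move=> P0 x01 xinc gap s1.
have PR : 0 < Phi%:R :> R by rewrite ltr0n.
have d0 : 0 < 144 / Phi%:R :> R by rewrite divr_gt0.
pose L := (Phi %/ 6).+1.
have [|//||] := @fejer_interpolation n x (144 / Phi%:R) x01 xinc gap d0 L s.
- rewrite mulrA ler_pdivlMr//.
  have : (Phi <= 6 * L)%N by rewrite /L; lia.
  by rewrite -(ler_nat R) natrM; lra.
- move=> i; have := s1 i => /eqP; rewrite sqrf_eq1 => /orP[/eqP->|/eqP->].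
    by rewrite normr1.
  by rewrite normrN1.
move=> h [lh hx h2 [t ht]].
(* [v |-> (3 v - v ^ 3) / 2] maps [-2, 2] into [-1, 1] and fixes 1 and -1. *)
have h1 := h2; exists (fun t => 3 / 2 * h t + (- (1 / 2)) * (h t * (h t * h t))); split.
- exists (3 * (Phi %/ 6))%N; last by lia.
  apply: trig_polyD; apply: trig_polyZ; first by apply: trig_poly_le lh; rewrite /L /=; lia.
  apply: (@trig_poly_le (Phi %/ 6 + (Phi %/ 6 + Phi %/ 6))); first by lia.
  by do 2 apply: trig_polyM => //.
(* The distances of the cubic to -1 and to 1 have a double root at -1 and at 1 respectively; the
   remaining factors 2 - v and 2 + v are nonnegative on [-2, 2]. *)
- move=> u; have := h2 u; move: (h u) => v; rewrite !ler_norml => /andP[v1 v2].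
  apply/andP; split; rewrite -subr_ge0.
    rewrite (_ : _ - _ = (v + 1) ^+ 2 * (2 - v) / 2); last by field.
    by apply: divr_ge0 => //; apply: mulr_ge0; [exact: sqr_ge0|lra].
  rewrite (_ : _ - _ = (v - 1) ^+ 2 * (2 + v) / 2); last by field.
  by apply: divr_ge0 => //; apply: mulr_ge0; [exact: sqr_ge0|lra].
- by move=> i; rewrite hx -expr2 s1; lra.
- exists t; move: ht; move: (h t) => v; rewrite !ltr_norml => /andP[v1 v2].
  apply/andP; split; rewrite -subr_gt0.
    rewrite (_ : _ - _ = (v + 1) ^+ 2 * (2 - v) / 2); last by field.
    by apply: divr_gt0 => //; apply: mulr_gt0; [apply: exprn_gt0|]; lra.
  rewrite (_ : _ - _ = (v - 1) ^+ 2 * (2 + v) / 2); last by field.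
  apply: divr_gt0 => //; apply: mulr_gt0; last lra.
  by rewrite lt_neqAle sqr_ge0 andbT eq_sym sqrf_eq0; apply/eqP; lra.
Qed.

End TrigPoly.

(** * Sums of plane waves *)

Section ModeSums.
Context {R : realType}.
Local Notation plane := (measurableTypeR R * measurableTypeR R)%type.

(* The boolean [d] selects an axis: [true] for x, [false] for y. *)
Definition axis_point (d : bool) (s t : R) : R * R := if d then (s, t) else (t, s).
Definition axis_coord (d : bool) (p : R * R) : R := if d then p.1 else p.2.
Definition axis_partial (d : bool) := if d then @partial_x R else @partial_y R.
Definition freq_at (d : bool) (k l : int) : int * int := if d then (k, l) else (l, k).

Lemma axis_point_continuous d (g : R * R -> R) t : continuous g ->
    continuous (fun s => g (axis_point d s t)).
Proof.
move=> cg s; apply: (@continuous_comp _ _ _ (fun s : R => axis_point d s t) g); last exact: cg.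
by rewrite /axis_point; case: d => A [[P Q] /= [hP hQ] PQA];
  [apply: filterS hP => s' Ps'|apply: filterS hQ => s' Qs'];
  apply: PQA; split => //=; exact: nbhs_singleton.
Qed.

Lemma axis_partialE d phi s t : axis_partial d phi (axis_point d s t) =
    derive1 (fun s => phi (axis_point d s t)) s.
Proof. by case: d. Qed.

Lemma axis_pointK d p : axis_point d (axis_coord d p) (axis_coord (~~ d) p) = p.
Proof. by case: d p => -[a b]. Qed.

Definition phase (k : int * int) (p : R * R) : R := 2 * pi * (k.1%:~R * p.1 + k.2%:~R * p.2).

Definition wave (k : int * int) (p : R * R) : R[i] := expi (phase k p).

(** A complex amplitude with a frequency. Real trigonometric polynomials on the torus are encoded as
    lists of modes, so that derivatives, products and integrals become computations on lists. *)
Definition mode : Type := (R[i] * (int * int))%type.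

Definition mode_fun (q : mode) (p : R * R) : R := complex.Re (q.1 * wave q.2 p).

Definition mode_sum (s : seq mode) (p : R * R) : R := \sum_(q <- s) mode_fun q p.

Definition mode_deriv (d : bool) (q : mode) : mode :=
  (q.1 * ('i * (2 * pi * (if d then q.2.1 else q.2.2)%:~R)%:C), q.2).
Definition modes_deriv d (s : seq mode) := map (mode_deriv d) s.

Lemma mode_funE q p : mode_fun q p =
    complex.Re q.1 * cos (phase q.2 p) - complex.Im q.1 * sin (phase q.2 p).
Proof. by rewrite /mode_fun; case: q.1 => a b; rewrite /wave /expi. Qed.

Lemma mode_fun_derive d q (s t : R) :
  is_derive s (1 : R) (fun z : R => mode_fun q (axis_point d z t)) (mode_fun (mode_deriv d q)
      (axis_point d s t)).
Proof.
rewrite (_ : (fun z : R => _) = (fun z : R => complex.Re q.1 * cos (phase q.2 (axis_point d z t)) -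
   complex.Im q.1 * sin (phase q.2 (axis_point d z t)))); last first.
  by apply/funext => z; rewrite mode_funE.
rewrite mode_funE /phase; case: d => /=; apply: is_derive_eq; rewrite /= /GRing.scale /=;
  by case: q => [[a b] [k l]] /=; simpc; rewrite /=; ring.
Qed.

Lemma mode_sum_cons q s p : mode_sum (q :: s) p = mode_fun q p + mode_sum s p.
Proof. by rewrite /mode_sum big_cons. Qed.

Lemma mode_sum_cat s s' p : mode_sum (s ++ s') p = mode_sum s p + mode_sum s' p.
Proof. by rewrite /mode_sum big_cat. Qed.

Lemma mode_sum_nil : mode_sum [::] = fun=> 0.
Proof. by apply/funext => p; rewrite /mode_sum big_nil. Qed.

Definition mode_scale (c : R) (q : mode) : mode := (c%:C * q.1, q.2).

Lemma mode_sum_scale c s p : mode_sum (map (mode_scale c) s) p = c * mode_sum s p.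
Proof.
rewrite /mode_sum big_map mulr_sumr; apply: eq_bigr => q _.
by rewrite /mode_fun /mode_scale /=; case: q => [[a b] k] /=; rewrite /wave /expi; simpc;
    rewrite /=; ring.
Qed.

Lemma mode_sum_derive d s (x y : R) :
  is_derive x (1 : R) (fun z : R => mode_sum s (axis_point d z y)) (mode_sum (modes_deriv d s)
      (axis_point d x y)).
Proof.
elim: s => [|q s IH].
  rewrite /= mode_sum_nil; exact: is_derive_cst.
rewrite /modes_deriv /= -/(modes_deriv d s) mode_sum_cons.
rewrite (_ : (fun z => _) = (fun z => mode_fun q (axis_point d z y)) + (fun z => mode_sum s
    (axis_point d z y))); last first.
  by apply/funext => z; rewrite mode_sum_cons.
by apply: is_deriveD; exact: mode_fun_derive.
Qed.

Lemma axis_partial_mode_sum d s : axis_partial d (mode_sum s) = mode_sum (modes_deriv d s).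
Proof.
apply/funext => p; rewrite -(axis_pointK d p) axis_partialE derive1E.
by apply: derive_val; exact: mode_sum_derive.
Qed.

Lemma phase_continuous k : continuous (phase k).
Proof.
move=> p; rewrite /phase; apply: cvgM; first exact: cvg_cst.
apply: cvgD; (apply: cvgM; first exact: cvg_cst); [exact: cvg_fst|exact: cvg_snd].
Qed.

Lemma mode_fun_continuous q : continuous (mode_fun q).
Proof.
rewrite (_ : mode_fun q = fun p => complex.Re q.1 * cos (phase q.2 p) -
   complex.Im q.1 * sin (phase q.2 p)); last by apply/funext => z; rewrite mode_funE.
move=> p; apply: cvgB; (apply: cvgM; first exact: cvg_cst).
  apply: continuous_comp; [exact: phase_continuous|exact: continuous_cos].
apply: continuous_comp; [exact: phase_continuous|exact: continuous_sin].
Qed.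

Lemma mode_sum_continuous s : continuous (mode_sum s).
Proof.
elim: s => [|q s IH]; first by rewrite mode_sum_nil => p; exact: cvg_cst.
rewrite (_ : mode_sum _ = (fun p => mode_fun q p + mode_sum s p)); last by apply/funext => p;
    rewrite mode_sum_cons.
by move=> p; apply: cvgD; [exact: mode_fun_continuous|exact: IH].
Qed.

Lemma cosD2pi_int (a : R) (k : int) : cos (a + 2 * pi * k%:~R) = cos a.
Proof.
have H b (n : nat) : cos (b + 2 * pi * n%:R) = cos b :> R.
  by rewrite mulr_natr mulr_natl periodicn//; exact: cosD2pi.
case: k => n; first by rewrite -pmulrn H.
by rewrite NegzE mulrNz mulrN -(H _ n.+1) -pmulrn subrK.
Qed.

Lemma sinD2pi_int (a : R) (k : int) : sin (a + 2 * pi * k%:~R) = sin a.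
Proof. by rewrite -cosBpihalf addrAC cosD2pi_int cosBpihalf. Qed.

Lemma mode_sum_periodic d s x y : mode_sum s (axis_point d (x + 1) y) =
    mode_sum s (axis_point d x y).
Proof.
apply: eq_bigr => q _; rewrite !mode_funE.
have -> : phase q.2 (axis_point d (x + 1) y) =
    phase q.2 (axis_point d x y) + 2 * pi * (if d then q.2.1 else q.2.2)%:~R.
  by rewrite /phase; case: d => /=; ring.
by rewrite cosD2pi_int sinD2pi_int.
Qed.

(** Partial derivatives of sums of modes are again sums of modes, so the induction on the order of
    differentiability runs over all lists at once. *)
Lemma mode_sum_smooth s : smooth_torus (mode_sum s).
Proof.
split; last by move=> x y; rewrite (mode_sum_periodic true) (mode_sum_periodic false).
move=> k; elim: k s => [|k IH] s /=; split => //; try exact: mode_sum_continuous.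
split.
- by move=> p; have [] := mode_sum_derive true s p.1 p.2.
- by move=> p; have [] := mode_sum_derive false s p.2 p.1.
- by rewrite (_ : partial_x (mode_sum s) = mode_sum (modes_deriv true s));
    [exact: IH|exact: (axis_partial_mode_sum true)].
- by rewrite (_ : partial_y (mode_sum s) = mode_sum (modes_deriv false s));
    [exact: IH|exact: (axis_partial_mode_sum false)].
Qed.

Lemma mode_sum_measurable s : measurable_fun [set: plane] (mode_sum s : plane -> R).
Proof.
elim: s => [|q s IH]; first by rewrite mode_sum_nil; exact: measurable_cst.
rewrite (_ : mode_sum _ = (fun p => mode_fun q p + mode_sum s p)); last by apply/funext => p;
    rewrite mode_sum_cons.
apply: measurable_funD => //.
rewrite (_ : mode_fun q = fun p => complex.Re q.1 * cos (phase q.2 p) -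
   complex.Im q.1 * sin (phase q.2 p)); last by apply/funext => z; rewrite mode_funE.
have ma : measurable_fun [set: plane] (phase q.2 : plane -> R).
  apply: measurable_funM; first exact: measurable_cst.
  apply: measurable_funD; (apply: measurable_funM; first exact: measurable_cst).
    exact: measurable_fst.
  exact: measurable_snd.
apply: measurable_funB; (apply: measurable_funM; first exact: measurable_cst).
  by apply: measurableT_comp ma; apply: continuous_measurable_fun; exact: continuous_cos.
by apply: measurableT_comp ma; apply: continuous_measurable_fun; exact: continuous_sin.
Qed.

Lemma mode_sum_bounded s : exists M : R, forall p, `|mode_sum s p| <= M.
Proof.
elim: s => [|q s [M hM]]; first by exists 0 => p; rewrite mode_sum_nil normr0.
exists (`|complex.Re q.1| + `|complex.Im q.1| + M) => p; rewrite mode_sum_cons.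
apply: le_trans (ler_normD _ _) _; apply: lerD => //; rewrite mode_funE.
apply: le_trans (ler_normB _ _) _; rewrite !normrM.
by apply: lerD; rewrite ler_piMr// ?cos_max ?sin_max.
Qed.

(** * Integrability on the torus and pairings with plane waves *)

Lemma torus_measurable : measurable (torus : set plane).
Proof. by apply: measurableX; exact: measurable_itv. Qed.

Lemma leb2_torus : leb2 (torus : set plane) = 1%E.
Proof.
transitivity (lebesgue_measure (`[0%R, 1%R[ : set R) * lebesgue_measure (`[0%R, 1%R[ : set R))%E.
  by apply: product_measure1E; exact: measurable_itv.
by rewrite !lebesgue_measure_itv /= lte_fin ltr01 oppr0 !adde0 mule1.
Qed.

Definition torus_integrable (v : R * R -> R) := leb2.-integrable (torus : set plane) (EFin \o v).

Lemma torus_integrableM v b : torus_integrable v ->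
    measurable_fun (torus : set plane) (b : plane -> R) ->
  (exists M : R, forall p, torus p -> `|b p| <= M) -> torus_integrable (fun p => v p * b p).
Proof.
move=> iv mb [M hM].
apply: (integrableMl torus_measurable iv mb).
exists `|M|; split; first exact: normr_real.
move=> x Mx p pT /=; apply: le_trans (hM _ pT) _; apply: ltW; apply: le_lt_trans Mx;
    exact: ler_norm.
Qed.

Lemma torus_integrable_bounded (f : R * R -> R) (B : R) : measurable_fun
    [set: plane] (f : plane -> R) ->
  (forall p, torus p -> `|f p| <= B) -> torus_integrable f.
Proof.
move=> mf fB.
have i1 : torus_integrable (fun=> 1 : R).
  apply/integrableP; split; first exact: measurable_cst.
  rewrite (eq_integral (cst 1%E)); last by move=> p _ /=; rewrite normr1.
  by rewrite integral_cst ?mul1e ?leb2_torus ?ltry//; exact: torus_measurable.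
rewrite (_ : f = (fun p => 1 * f p)); last by apply/funext => p; rewrite mul1r.
by apply: torus_integrableM => //; [exact: measurable_funTS|exists B].
Qed.

Lemma torus_integrable_mode_sum v s : torus_integrable v ->
    torus_integrable (fun p => v p * mode_sum s p).
Proof.
move=> iv; apply: torus_integrableM => //; first by apply: measurable_funTS;
    exact: mode_sum_measurable.
by have [M hM] := mode_sum_bounded s; exists M => p _.
Qed.

Definition torus_inner (v b : R * R -> R) : R := \int[leb2]_(p in torus) (v p * b p).

(** The integral of [v] against [wave k], that is, the Fourier coefficient at the frequency
    [- k]. *)
Definition fourier_mode v (k : int * int) : R[i] :=
  torus_inner v (fun p => cos (phase k p)) +i* torus_inner v (fun p => sin (phase k p)).

Lemma cos_mode_sum k : (fun p => cos (phase k p)) = mode_sum [:: (1, k)].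
Proof. by apply/funext => p; rewrite /mode_sum big_seq1 mode_funE /= mul1r mul0r subr0. Qed.

Lemma sin_mode_sum k : (fun p => sin (phase k p)) = mode_sum [:: (- 'i, k)].
Proof. by apply/funext => p; rewrite /mode_sum big_seq1 mode_funE /= mulN1r oppr0 mul0r sub0r
    opprK. Qed.

Lemma torus_integrableD v w : torus_integrable v -> torus_integrable w ->
    torus_integrable (fun p => v p + w p).
Proof. by move=> iv iw; exact: (integrableD torus_measurable iv iw). Qed.

Lemma torus_integrableZ c v : torus_integrable v -> torus_integrable (fun p => c * v p).
Proof. by move=> iv; exact: (integrableZl torus_measurable c iv). Qed.

(** A pairing with a trigonometric polynomial depends on [v] only through its modes at the
    frequencies in the list. *)
Lemma torus_inner_mode_sum v s : torus_integrable v ->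
  torus_inner v (mode_sum s) = complex.Re (\sum_(q <- s) q.1 * fourier_mode v q.2).
Proof.
move=> iv; elim: s => [|q s IH].
  rewrite big_nil mode_sum_nil /torus_inner; under eq_Rintegral do rewrite mulr0.
  by rewrite Rintegral_cst ?mul0r//; exact: torus_measurable.
rewrite big_cons raddfD /= -IH.
rewrite /torus_inner (_ : (fun p => _) = (fun p => v p * mode_fun q p + v p * mode_sum s p));
    last first.
  by apply/funext => p; rewrite mode_sum_cons mulrDr.
have h1 := torus_integrable_mode_sum s iv.
have h2 : torus_integrable (fun p => v p * cos (phase q.2 p)).
  by have := torus_integrable_mode_sum [:: (1, q.2)] iv; rewrite -cos_mode_sum.
have h3 : torus_integrable (fun p => v p * sin (phase q.2 p)).
  by have := torus_integrable_mode_sum [:: (- 'i, q.2)] iv; rewrite -sin_mode_sum.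
rewrite (_ : (fun p => v p * mode_fun q p + v p * mode_sum s p) = (fun p =>
   (complex.Re q.1 * (v p * cos (phase q.2 p)) +
   (- complex.Im q.1) * (v p * sin (phase q.2 p))) + v p * mode_sum s p)); last first.
  by apply/funext => p; rewrite mode_funE; ring.
have hm := torus_measurable.
rewrite RintegralD//; last by apply: torus_integrableD; exact: torus_integrableZ.
rewrite RintegralD//; [|exact: torus_integrableZ..].
rewrite !RintegralZl//; congr (_ + _).
by rewrite /fourier_mode /torus_inner; case: q.1 => a b /=; rewrite mulNr.
Qed.

End ModeSums.

(** * The recurrence for Fourier modes *)

Section Recurrence.
Context {R : realType}.
Local Notation plane := (measurableTypeR R * measurableTypeR R)%type.

(** The leading coefficient of [P] determines the last term of a window from the earlier ones, which
    carries zeros upwards; the lowest nonzero coefficient determines the first relevant term and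
    carries them downwards. *)
Lemma linear_recurrence_eq0 (F : fieldType) (P : {poly F}) (n : nat) (a : int -> F) :
  P != 0 -> (size P <= n.+1)%N ->
  (forall k : int, \sum_(j < n.+1) P`_j * a (k + j%:Z) = 0) ->
  (forall k : nat, (k < n)%N -> a k%:Z = 0) -> forall k, a k = 0.
Proof.
move=> P0 sP rec a0.
have sP0 : (0 < size P)%N by rewrite size_poly_gt0.
have fwd (m : nat) : a m%:Z = 0.
  elim/ltn_ind: m => m IH; have [mn|nm] := ltnP m n; first exact: a0.
  have sn : ((size P).-1 < n.+1)%N by lia.
  (* The window is placed so that the leading coefficient meets [a m]. The earlier indices stay
     nonnegative since the degree of [P] is at most [n], and [n <= m]. *)
  have := rec (m%:Z - (size P).-1%:Z).
  rewrite (bigD1 (Ordinal sn)) //= big1 ?addr0.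
    rewrite subrK => /eqP; rewrite mulf_eq0 -lead_coefE lead_coef_eq0 (negbTE P0) /=.
    by move/eqP.
  move=> j js; have [jl|jl] := leqP (size P) j.
    by rewrite nth_default ?mul0r.
  have jl' : (j < (size P).-1)%N.
    rewrite ltn_neqAle -ltnS prednK// jl andbT.
    by apply: contra js => /eqP e; apply/eqP/val_inj.
  have aux q jj mm : (jj < q)%N -> (q <= mm)%N ->
      (mm%:Z - q%:Z + jj%:Z = (mm - (q - jj))%N%:Z) /\ (mm - (q - jj) < mm)%N by lia.
  have [-> lt] := aux _ _ m jl' (leq_trans (sn : _ <= n)%N nm).
  by rewrite IH ?mulr0.
have [v Pv vmin] : exists2 v, P`_v != 0 & forall j, (j < v)%N -> P`_j = 0.
  have ex : exists v, P`_v != 0.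
    by exists (size P).-1; rewrite -lead_coefE lead_coef_eq0.
  exists (ex_minn ex); first by case: ex_minnP.
  case: ex_minnP => v _ h j jv; apply/eqP/negPn/negP => /h; lia.
have vn : (v < n.+1)%N.
  rewrite ltnNge; apply: contra Pv => nv; rewrite nth_default//; exact: leq_trans sP nv.
(* Counting down from [n - 1] makes the first [n] cases of this induction instances of [fwd]. *)
have bwd (m : nat) : a (n%:Z - 1 - m%:Z) = 0.
  elim/ltn_ind: m => m IH; have [mn|nm] := ltnP m n.
    by rewrite (_ : _ - _ = (n - 1 - m)%N%:Z) ?fwd//; lia.
  have := rec (n%:Z - 1 - m%:Z - v%:Z).
  rewrite (bigD1 (Ordinal vn)) //= big1 ?addr0.
    by rewrite subrK => /eqP; rewrite mulf_eq0 (negbTE Pv) => /eqP.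
  move=> j js; have [jv|vj] := ltnP j v; first by rewrite vmin ?mul0r.
  have vj' : (v < j)%N.
    by rewrite ltn_neqAle vj andbT; apply: contra js => /eqP e; apply/eqP/val_inj.
  have jn := ltn_ord j.
  rewrite (_ : _ + j%:Z = n%:Z - 1 - (m - (j - v))%N%:Z); last by lia.
  by rewrite IH ?mulr0//; lia.
case=> m; first exact: fwd.
by have := bwd (n + m)%N; rewrite (_ : _ - _ = Negz m)//; lia.
Qed.

Lemma turnX (t : R) n : turn t ^+ n = turn (n%:R * t).
Proof. by rewrite /turn expiX; congr expi; ring. Qed.

(** Undoes the shift of the exponents: the frequencies run from [- d] to [d]. *)
Lemma trig_polyE d (f : R -> R) : trig_poly d f -> exists P : {poly R[i]}, (size P <= d.*2.+1)%N /\
  forall t, (f t)%:C = \sum_(j < d.*2.+1) P`_j * turn ((j%:Z - d%:Z)%:~R * t).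
Proof.
move=> [P [sP fP]]; exists P; split => // t.
have -> : (f t)%:C = P.[turn t] * turn (- t) ^+ d.
  by rewrite -fP -mulrA -exprMn -turnD subrr /turn mulr0 expi0 expr1n mulr1.
rewrite (horner_coef_wide _ sP) mulr_suml; apply: eq_bigr => j _.
rewrite -mulrA !turnX -turnD; congr (_ * turn _).
by rewrite rmorphB /= -!pmulrn; ring.
Qed.

Lemma waveE k (p : R * R) : wave k p = turn (k.1%:~R * p.1) * turn (k.2%:~R * p.2).
Proof. by rewrite -turnD /wave /phase /turn. Qed.

Lemma turn_int (k m : int) (t : R) : turn ((k + m)%:~R * t) = turn (k%:~R * t) * turn (m%:~R * t).
Proof. by rewrite intrD mulrDl turnD. Qed.

Lemma Re_sum (I : Type) (r : seq I) (F : I -> R[i]) :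
  complex.Re (\sum_(i <- r) F i) = \sum_(i <- r) complex.Re (F i).
Proof. exact: raddf_sum. Qed.

Lemma trig_poly_prod d d' (f g : R -> R) : trig_poly d f -> trig_poly d' g ->
  exists s, forall p, f p.1 * g p.2 = mode_sum s p.
Proof.
move=> /trig_polyE[P [sP fP]] /trig_polyE[Q [sQ gQ]].
exists [seq (P`_(nat_of_ord j) * Q`_(nat_of_ord l),
   (j%:Z - d%:Z, l%:Z - d'%:Z)) | j <- index_enum 'I_(d.*2.+1), l <- index_enum 'I_(d'.*2.+1)].
move=> p; rewrite /mode_sum big_allpairs_dep.
have -> : f p.1 * g p.2 = complex.Re ((f p.1)%:C * (g p.2)%:C) by simpc.
rewrite fP gQ mulr_suml Re_sum; apply: eq_bigr => j _.
rewrite mulr_sumr Re_sum; apply: eq_bigr => l _.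
by rewrite /mode_fun /= waveE; congr complex.Re; ring.
Qed.

Lemma trig_poly_x d (f : R -> R) : trig_poly d f -> exists s, forall p, f p.1 = mode_sum s p.
Proof.
move=> lf; have [s hs] := trig_poly_prod lf (trig_poly_const 0 (1 : R)).
by exists s => p; rewrite -hs mulr1.
Qed.

Lemma Re_eq0 (z : R[i]) : (forall c, complex.Re (c * z) = 0) -> z = 0.
Proof.
move=> h; have := h 1; have := h (- 'i); case: z {h} => a b.
by simpc => /= -> ->.
Qed.

(** Removes the factor 2 pi i that differentiation brings in, bracketed as it arises from
    [mode_deriv]. *)
Lemma frequency_cancel (m : int) (X : R[i]) :
  m%:~R * X = - 'i * (((2 * pi)^-1)%:C * ('i * ((2 * (pi * m%:~R))%:C * X))).
Proof.
have pi0 : 2 * pi != 0 :> R by rewrite mulf_neq0// gt_eqF// pi_gt0.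
have e1 : ((2 * pi)^-1)%:C * (2 * pi)%:C = 1 :> R[i].
  by rewrite -[LHS]/(real_complex R _ * real_complex R _) -rmorphM mulVf ?rmorph1.
have e2 : - 'i * 'i = 1 :> R[i] by rewrite mulNr -expr2 sqr_i opprK.
have -> : (2 * (pi * m%:~R))%:C = (2 * pi)%:C * m%:~R :> R[i].
  by rewrite mulrA -[LHS]/(real_complex R _) rmorphM /= rmorph_int.
by rewrite -[LHS]mul1r -{1}e1 -[LHS]mul1r -{1}e2; ring.
Qed.

Lemma wave_shift d n k l (p : R * R) : turn (n%:~R * axis_coord d p) * wave (freq_at d k l) p =
    wave (freq_at d (k + n) l) p.
Proof. by rewrite !waveE; case: d; rewrite /= turn_int; ring. Qed.

(* The Fourier modes of [v - u] along the axis [d], multiplied by the frequency,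
   satisfy a linear recurrence with the coefficients of [w]; its order is at most
   the number of consecutive modes known to vanish. *)
Lemma fourier_row_eq d D (w : R -> R) (v u : R * R -> R) (l : int) :
  torus_integrable v -> torus_integrable u -> trig_poly D w -> (exists t, w t != 0) ->
  (forall s, torus_inner v (axis_partial d (fun p => w (axis_coord d p) * mode_sum s p)) =
             torus_inner u (axis_partial d (fun p => w (axis_coord d p) * mode_sum s p))) ->
  (forall k : int, `|k| <= D%:Z -> fourier_mode v (freq_at d k l) =
      fourier_mode u (freq_at d k l)) ->
  forall k, fourier_mode v (freq_at d k l) = fourier_mode u (freq_at d k l).
Proof.
move=> iv iu /trig_polyE[P [sP wP]] [t0 wt0] vu low.
have P0 : P != 0.
  apply: contra wt0 => /eqP P0; have := wP t0; rewrite P0 big1; last first.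
    by move=> j _; rewrite coef0 mul0r.
  by move=> /eqP; rewrite eq_complex /= => /andP[].
pose sx (c : R[i]) (k : int) : seq (@mode R) :=
  [seq (P`_(nat_of_ord j) * c, freq_at d (k + (j%:Z - D%:Z)) l) | j <- index_enum 'I_(D.*2.+1)].
have sxE c k : (fun p => w (axis_coord d p) * mode_sum [:: (c, freq_at d k l)] p) =
    mode_sum (sx c k).
  apply/funext => p; rewrite /mode_sum big_seq1 big_map.
  have -> : w (axis_coord d p) * mode_fun (c, freq_at d k l) p =
      complex.Re ((w (axis_coord d p))%:C * (c * wave (freq_at d k l) p)).
    by rewrite /mode_fun /=; case: (c * _) => a b; simpc.
  rewrite wP mulr_suml Re_sum; apply: eq_bigr => j _.
  by rewrite /mode_fun /= -wave_shift; congr complex.Re; ring.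
(* The index is shifted by [D], so that the known frequencies from [- D] to [D - 1] become the
   initial indices from 0 to [2 D - 1]. *)
pose a (k : int) := (k - D%:Z)%:~R *
  (fourier_mode v (freq_at d (k - D%:Z) l) - fourier_mode u (freq_at d (k - D%:Z) l)).
have rec k : \sum_(j < D.*2.+1) P`_j * a (k + j%:Z) = 0.
  apply: Re_eq0 => c.
  (* This amplitude absorbs the factor 2 pi i of the derivative and leaves the arbitrary [c]. *)
  pose c' := c * - 'i * ((2 * pi)^-1)%:C.
  have := vu [:: (c', freq_at d k l)]; rewrite sxE axis_partial_mode_sum !torus_inner_mode_sum//.
  move=> /eqP; rewrite -subr_eq0 -raddfB /= /modes_deriv !big_map -sumrB => /eqP <-.
  congr complex.Re; rewrite mulr_sumr; apply: eq_bigr => j _.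
  rewrite /= (_ : k + (j%:Z - D%:Z) = k + j%:Z - D%:Z); last by rewrite addrA.
  rewrite (_ : (if d then _ else _) = k + j%:Z - D%:Z); last by case: (d).
  rewrite /a -mulrBr mulrCA -!mulrA; congr (_ * _).
  by congr (_ * _); exact: frequency_cancel.
have az k : a k = 0.
  apply: (linear_recurrence_eq0 P0 _ rec) => // m mD; rewrite /a low ?subrr ?mulr0//.
  by rewrite ler_norml; lia.
(* The recurrence controls only frequency times mode; at frequency 0 the mode is among the known
   ones. *)
move=> k; have [->|k0] := eqVneq k 0; first by apply: low; rewrite normr0.
have := az (k + D%:Z); rewrite /a addrK => /eqP; rewrite mulf_eq0 intr_eq0 (negbTE k0) /=.
by rewrite subr_eq0 => /eqP.
Qed.

End Recurrence.

(** * Approximation of arcs by trigonometric polynomials *)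

Section ArcApprox.
Context {R : realType}.
Local Notation plane := (measurableTypeR R * measurableTypeR R)%type.

Lemma bernoulli_le (a : R) n : 0 <= a <= 1 -> 1 - n%:R * a <= (1 - a) ^+ n.
Proof.
move=> /andP[a0 a1]; elim: n => [|n IH]; first by rewrite mul0r subr0.
rewrite exprS; have h : 0 <= 1 - a by lra.
apply: le_trans (ler_wpM2l h IH).
rewrite -natr1; have : 0 <= n%:R * (a * a) by rewrite !mulr_ge0.
by move: (n%:R) => m; nra.
Qed.

Lemma bernoulli_ge (a : R) n : 0 <= a -> 1 + n%:R * a <= (1 + a) ^+ n.
Proof.
move=> a0; elim: n => [|n IH]; first by rewrite mul0r addr0.
rewrite exprS; have h : 0 <= 1 + a by lra.
apply: le_trans (ler_wpM2l h IH).
rewrite -natr1; have : 0 <= n%:R * (a * a) by rewrite !mulr_ge0.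
by move: (n%:R) => m; nra.
Qed.

(* Converges to 1 for [0 <= y < 1/2] and to 0 for [1/2 < y <= 1]. *)
Definition step_approx n (y : R) : R := (1 - y ^+ n) ^+ (2 ^ n).

Lemma step_approx01 n y : 0 <= y <= 1 -> 0 <= step_approx n y <= 1.
Proof.
move=> /andP[y0 y1]; rewrite /step_approx; have h0 := exprn_ge0 n y0; have h1 := exprn_ile1 n y0 y1.
by rewrite exprn_ge0 ?exprn_ile1//; lra.
Qed.

(** Bernoulli's inequality gives the lower bound 1 - (2 y)^n, and 2 y < 1. *)
Lemma step_approx_lt y : 0 <= y < 1 / 2 -> step_approx n y @[n --> \oo] --> (1 : R).
Proof.
move=> /andP[y0 y2].
apply: (@squeeze_cvgr _ _ _ _ (fun n => 1 - (2 * y) ^+ n) (cst 1)).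
- apply: nearW => n; have /andP[_ ->] : 0 <= step_approx n y <= 1 by apply: step_approx01; lra.
  rewrite andbT /step_approx exprMn -natrX; apply: bernoulli_le.
  by rewrite exprn_ge0//= exprn_ile1//; lra.
- rewrite -[X in _ --> X]subr0; apply: cvgB; first exact: cvg_cst.
  by apply: cvg_expr; rewrite ger0_norm; lra.
- exact: cvg_cst.
Qed.

(** Multiplied by (1 + y^n)^(2^n), which is at least (2 y)^n by Bernoulli's inequality, the value
    becomes (1 - y^(2 n))^(2^n) <= 1. So it is at most (2 y)^(-n). *)
Lemma step_approx_gt y : 1 / 2 < y <= 1 -> step_approx n y @[n --> \oo] --> (0 : R).
Proof.
move=> /andP[y2 y1]; have y0 : 0 <= y by lra.
apply: (@squeeze_cvgr _ _ _ _ (cst 0) (fun n => ((2 * y)^-1) ^+ n)).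
- apply: nearW => n; have /andP[-> _] /= : 0 <= step_approx n y <= 1 by apply: step_approx01; lra.
  have h0 := exprn_ge0 n y0; have h1 := exprn_ile1 n y0 y1.
  have p : 0 < (2 * y) ^+ n by rewrite exprn_gt0//; lra.
  rewrite exprVn -[X in _ <= X]mul1r ler_pdivlMr//.
  apply: (@le_trans _ _ (step_approx n y * (1 + y ^+ n) ^+ (2 ^ n))).
    apply: ler_wpM2l; first by rewrite /step_approx exprn_ge0//; lra.
    apply: le_trans (bernoulli_ge _ h0); rewrite natrX -exprMn; lra.
  rewrite /step_approx -exprMn; apply: exprn_ile1; nra.
- exact: cvg_cst.
- by apply: cvg_expr; rewrite ger0_norm ?invr_ge0 ?invf_lt1; lra.
Qed.

Lemma trig_poly_exp d (f : R -> R) n : trig_poly d f -> trig_poly (n * d) (fun t => f t ^+ n).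
Proof.
move=> lf; elim: n => [|n IH]; first exact: trig_poly_const.
rewrite mulSn (_ : (fun t => _) = (fun t => f t * f t ^+ n)); first exact: trig_polyM.
by apply/funext => t; rewrite exprS.
Qed.

Lemma trig_poly_cos : trig_poly 1 (fun t : R => cos (2 * pi * t)).
Proof.
exists ((2^-1)%:C *: ('X ^+ 2 + 1)); split.
  apply: leq_trans (size_scale_leq _ _) _; apply: leq_trans (size_polyD _ _) _.
  by rewrite size_polyXn size_poly1.
move=> t; rewrite hornerZ hornerD hornerXn hornerC expr1 /turn /expi.
have := cos2Dsin2 (2 * pi * t); move: (cos _) (sin _) => c s h.
rewrite expr2; simpc; congr (_ +i* _); last by field.
have -> : s * s = 1 - c * c by move: h; rewrite !expr2 => h; lra.
by field.
Qed.

(** The cosine decreases in the distance to [c] up to 1/2. Beyond 1/2, |t - c| is replaced by 1 - |t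
    - c|, which still exceeds [h] because the arc lies within the unit interval. *)
Lemma cos_arc (c h t : R) : 0 <= c - h -> 0 < h -> c + h < 1 -> 0 <= t < 1 ->
  ((`|t - c| < h -> cos (2 * pi * h) < cos (2 * pi * (t - c))) *
  (h < `|t - c| -> cos (2 * pi * (t - c)) < cos (2 * pi * h)))%type.
Proof.
move=> ch h0 ch1 /andP[t0 t1]; have pi0 := pi_gt0 R.
have -> : cos (2 * pi * (t - c)) = cos (2 * pi * `|t - c|).
  by rewrite -cos_norm normrM ger0_norm//; nra.
have H (a b : R) : 0 <= a <= 1 / 2 -> 0 <= b <= 1 / 2 ->
    a < b -> cos (2 * pi * b) < cos (2 * pi * a).
  move=> /andP[a0 a1] /andP[b0 b1] ab; rewrite ltr_cos ?in_itv /=; nra.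
split => [lt|gt]; first by apply: H => //; rewrite ?normr_ge0; lra.
have [le|lt] := leP `|t - c| (1 / 2); first by apply: H => //; rewrite ?normr_ge0; lra.
rewrite (_ : cos (2 * pi * `|t - c|) = cos (2 * pi * (1 - `|t - c|))).
  move: gt lt; have [p|p] := leP 0 (t - c); [rewrite ger0_norm//|rewrite ltr0_norm//] => gt lt;
  by apply: H; lra.
by rewrite mulrBr mulr1 cosB mulr_natl cos2pi sin2pi mul1r mul0r addr0.
Qed.

Lemma arc_approx (a b : R) : 0 <= a -> a < b -> b < 1 -> exists S : nat -> R -> R,
  [/\ forall n, exists d, trig_poly d (S n), forall n t, 0 <= S n t <= 1 &
   forall t, 0 <= t < 1 -> t != a -> t != b ->
     S n t @[n --> \oo] --> (((a < t) && (t < b))%:R : R)].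
Proof.
move=> a0 ab b1; pose c := (a + b) / 2; pose h := (b - a) / 2.
(* The difference of cosines lies in [-2, 2], so the factor 1/4 keeps [y] in [0, 1]; it crosses 1/2
   exactly at the end points of the arc. *)
pose y t : R := 1 / 2 + (1 / 4) * (cos (2 * pi * (t - c)) + - cos (2 * pi * h)).
have y01 t : 0 <= y t <= 1.
  have := cos_le1 (2 * pi * (t - c)); have := cos_geN1 (2 * pi * (t - c)).
  have := cos_le1 (2 * pi * h); have := cos_geN1 (2 * pi * h).
  by rewrite /y; lra.
have ly : trig_poly 1 y.
  apply: trig_polyD; first exact: trig_poly_const.
  apply: trig_polyZ; apply: trig_polyD; last exact: trig_poly_const.
  exact: (trig_poly_shift c trig_poly_cos).
exists (fun n t => 1 + (-1) * step_approx n (y t)); split.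
- move=> n; exists (2 ^ n * (n * 1))%N; apply: trig_polyD; first exact: trig_poly_const.
  apply: trig_polyZ; apply: (@trig_poly_exp (n * 1) (fun t => 1 - y t ^+ n)).
  rewrite (_ : (fun t => _) = (fun t => 1 + (-1) * y t ^+ n)).
    apply: trig_polyD; first exact: trig_poly_const.
    by apply: trig_polyZ; exact: trig_poly_exp.
  by apply/funext => t; rewrite mulN1r.
- by move=> n t; have := step_approx01 n (y01 t); lra.
- move=> t t01 ta tb.
  have hc : (`|t - c| < h) = ((a < t) && (t < b)).
    by rewrite ltr_norml /c /h; apply/idP/idP; lra.
  have [lt gt] := @cos_arc c h t ltac:(rewrite /c /h; lra) ltac:(rewrite /h; lra)
     ltac:(rewrite /c /h; lra) t01.
  case: ltP hc => [/lt ht <-|ge <-] /=.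
    rewrite mulr1n -[X in _ --> X]addr0 -[X in _ --> (_ + X)](mulr0 (-1)).
    apply: cvgD; first exact: cvg_cst.
    apply: cvgM; first exact: cvg_cst.
    by apply: step_approx_gt; have /andP[_ ->] := y01 t; rewrite /y; lra.
  have hlt : h < `|t - c|.
    rewrite lt_neqAle ge andbT; apply/negP => /eqP e.
    have [tc|tc] := leP 0 (t - c).
      by move: e tb; rewrite ger0_norm// /h /c => e /eqP; apply; lra.
    by move: e ta; rewrite ltr0_norm// /h /c => e /eqP; apply; lra.
  rewrite mulr0n -[X in _ --> X](subrr 1) -[X in _ --> (_ - X)]mul1r -mulNr.
  apply: cvgD; first exact: cvg_cst.
  apply: cvgM; first exact: cvg_cst.
  apply: step_approx_lt; have /andP[-> _] := y01 t; have := gt hlt; rewrite /y; lra.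
Qed.

End ArcApprox.

(** * Completeness of the Fourier system *)

Section Completeness.
Context {R : realType}.
Local Notation plane := (measurableTypeR R * measurableTypeR R)%type.

Lemma dominated_cvg_Rintegral d (T : measurableType d) (mu : {measure set T -> \bar R}) (D : set T)
  (f_ : nat -> T -> R) (f g : T -> R) : measurable D ->
  (forall n, measurable_fun D (f_ n)) -> measurable_fun D f ->
  {ae mu, forall x, D x -> f_ n x @[n --> \oo] --> f x} ->
  mu.-integrable D (EFin \o g) ->
  (forall n x, D x -> `|f_ n x| <= g x) ->
  \int[mu]_(x in D) f_ n x @[n --> \oo] --> \int[mu]_(x in D) f x.
Proof.
move=> mD mf_ mf ff ig fg.
have [|||||If _ cv] := @dominated_convergence _ T R mu D mD (fun n => EFin \o f_ n)
   (EFin \o f) (EFin \o g).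
- by move=> n; apply/measurable_EFinP.
- exact/measurable_EFinP.
- apply: filterS ff => x h Dx; apply: cvg_EFin; first exact: nearW.
  exact: h.
- exact: ig.
- by apply: aeW => x n Dx /=; rewrite lee_fin; exact: fg.
apply: fine_cvg; rewrite fineK; last exact: integrable_fin_num If.
exact: cv.
Qed.

(** Half-lines generate the Borel sets; the full line is added so that strips and the whole plane
    are among the rectangles. *)
Definition ray (A : set R) := A = setT \/ exists a : R, A = `]-oo, a[%classic.

(** Seen from [0, 1[, a half-line is empty, everything, or an arc that starts at 0. Only the last
    case needs [arc_approx], and 0 and [a] are then the end points of the arc. *)
Lemma ray_approx (A : set R) : ray A -> exists (S : nat -> R -> R) (a : R),
  [/\ forall n, exists d, trig_poly d (S n), forall n t, 0 <= S n t <= 1 &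
   forall t, 0 <= t < 1 -> t != 0 -> t != a ->
     S n t @[n --> \oo] --> (\1_A t : R)].
Proof.
have cst_case (c : R) : 0 <= c <= 1 -> (forall t, 0 <= t < 1 -> \1_A t = c) ->
  exists (S : nat -> R -> R) (a : R),
  [/\ forall n, exists d, trig_poly d (S n), forall n t, 0 <= S n t <= 1 &
   forall t, 0 <= t < 1 -> t != 0 -> t != a ->
     S n t @[n --> \oo] --> (\1_A t : R)].
  move=> c01 hc; exists (fun _ _ => c), 0; split => //.
    by move=> n; exists 0%N; exact: trig_poly_const.
  by move=> t t01 _ _; rewrite hc//; exact: cvg_cst.
case=> [eA|[a eA]].
  by apply: (cst_case 1) => [|t _]; [lra|rewrite eA indicT].
have [a0|a0] := leP a 0.
  apply: (cst_case 0) => [|t /andP[t0 t1]]; first lra.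
  by rewrite eA indicE memNset//= in_itv /= => /lt_le_trans /(_ a0); rewrite ltNge t0.
have [a1|a1] := leP 1 a.
  apply: (cst_case 1) => [|t /andP[t0 t1]]; first lra.
  by rewrite eA indicE mem_set//= in_itv /=; exact: lt_le_trans t1 a1.
have [S [lS S01 hS]] := arc_approx (lexx 0) a0 a1.
exists S, a; split => // t t01 tn0 ta; have := hS t t01 tn0 ta.
rewrite eA indicE; case/andP: t01 => t0 t1.
have -> : (0 < t) = true by rewrite lt_neqAle eq_sym tn0 t0.
rewrite andTb (_ : (t \in _) = (t < a))//.
by apply/idP/idP; rewrite inE /= in_itv.
Qed.

Lemma trig_poly_cont d (f : R -> R) : trig_poly d f -> continuous f.
Proof.
move=> /trig_poly_x[s hs] x; have -> : f = (fun x => mode_sum s (x, 0)) by apply/funext => t;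
    rewrite -hs.
have [h _] := mode_sum_derive true s x 0.
by apply: differentiable_continuous; apply/derivable1_diffP.
Qed.

Lemma ray_measurable A : ray A -> measurable (A : set (measurableTypeR R)).
Proof. by case=> [->|[a ->]]; [exact: measurableT|exact: measurable_itv]. Qed.

Definition ray_rects : set (set plane) := [set A `*` B | A in ray & B in ray].

Lemma measurable_ray (A : set R) : measurable (A : set (measurableTypeR R)) ->
  <<s [set A | exists x : R, A = `]-oo, x[%classic] >> A.
Proof.
move=> mA; suff : (@RGenInftyO.G R).-sigma.-measurable A by [].
by rewrite -RGenInftyO.measurableE.
Qed.

(** The sets whose strip lies in the generated sigma-algebra form a sigma-algebra that contains the
    half-lines, hence all Borel sets; a measurable rectangle is the intersection of two strips. *)
Lemma ray_rects_gen : @measurable _ plane = <<s ray_rects >>.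
Proof.
rewrite eqEsubset; split; last first.
  apply: smallest_sub; first exact: sigma_algebra_measurable.
  by move=> _ [A rA [B rB <-]]; apply: measurableX; exact: ray_measurable.
rewrite measurable_prod_measurableType.
have sG := @smallest_sigma_algebra _ setT ray_rects.
have half1 A : measurable (A : set (measurableTypeR R)) -> <<s ray_rects >> (A `*` setT).
  move=> /measurable_ray; move: A; apply: smallest_sub; last first.
    move=> _ [a ->]; apply: sub_sigma_algebra.
    by exists `]-oo, a[%classic; [right; exists a|exists setT; [left|]].
  split.
  - by rewrite /= set0X; case: sG.
  - move=> X /= hX; rewrite setTD (_ : ~` X `*` setT = setT `\` (X `*` setT)).
      by case: sG => _ /(_ _ hX).
    by apply/seteqP; split => -[a b] /=; tauto.
  - move=> F /= hF; rewrite (_ : _ `*` _ = \bigcup_k (F k `*` setT)).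
      by case: sG => _ _; exact.
    apply/seteqP; split => -[a b] /=; first by move=> [[k _ Fk] _]; exists k.
    by move=> [k _ [Fk _]]; split => //; exists k.
have half2 B : measurable (B : set (measurableTypeR R)) -> <<s ray_rects >> (setT `*` B).
  move=> /measurable_ray; move: B; apply: smallest_sub; last first.
    move=> _ [a ->]; apply: sub_sigma_algebra.
    by exists setT; [left|exists `]-oo, a[%classic; [right; exists a|]].
  split.
  - by rewrite /= setX0; case: sG.
  - move=> X /= hX; rewrite setTD (_ : setT `*` ~` X = setT `\` (setT `*` X)).
      by case: sG => _ /(_ _ hX).
    by apply/seteqP; split => -[a b] /=; tauto.
  - move=> F /= hF; rewrite (_ : _ `*` _ = \bigcup_k (setT `*` F k)).
      by case: sG => _ _; exact.
    apply/seteqP; split => -[a b] /=; first by move=> [_ [k _ Fk]]; exists k.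
    by move=> [k _ [_ Fk]]; split => //; exists k.
apply: smallest_sub => // _ [A mA [B mB <-]].
have -> : A `*` B = (A `*` setT) `&` (setT `*` B).
  by apply/seteqP; split => -[a b] /=; tauto.
have sI : setI_closed <<s ray_rects >>.
  exact: (@measurableI _ (g_sigma_algebraType ray_rects)).
by apply: sI; [exact: half1|exact: half2].
Qed.

Lemma ray_rects_setI : setI_closed ray_rects.
Proof.
have rI A B : ray A -> ray B -> ray (A `&` B).
  move=> [->|[a ->]]; first by rewrite setTI.
  move=> [->|[b ->]]; first by rewrite setIT; right; exists a.
  right; exists (Num.min a b); apply/seteqP; split => t /=; rewrite !in_itv /= lt_min.
    by move=> [-> ->].
  by move=> /andP.
move=> _ _ [A rA [B rB <-]] [A' rA' [B' rB' <-]].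
exists (A `&` A'); first exact: rI.
exists (B `&` B'); first exact: rI.
by apply/seteqP; split => -[a b] /=; tauto.
Qed.

(** Products of the approximations from [ray_approx] are trigonometric polynomials, to which [r] is
    orthogonal; dominated convergence with the bound |r| passes to the limit. *)
Lemma torus_inner_indic (r : R * R -> R) A B : torus_integrable r -> (forall s,
    torus_inner r (mode_sum s) = 0) ->
  ray A -> ray B -> \int[leb2]_(p in torus) (r p * (\1_A p.1 * \1_B p.2)) = 0.
Proof.
move=> ir r0 rA rB.
have [S [a [lS S01 cS]]] := ray_approx rA; have [T [b [lT T01 cT]]] := ray_approx rB.
have mr : measurable_fun (torus : set plane) r.
  by have /integrableP[/measurable_EFinP] := ir.
have hst n : exists s, forall p, S n p.1 * T n p.2 = mode_sum s p.
  by have [d ld] := lS n; have [d' ld'] := lT n; exact: trig_poly_prod ld ld'.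
have := @dominated_cvg_Rintegral _ plane leb2 torus (fun n p => r p * (S n p.1 * T n p.2))
   (fun p => r p * (\1_A p.1 * \1_B p.2)) (fun p => `|r p|) torus_measurable.
have mi (X : set R) : ray X -> measurable_fun [set: R] (\1_X : R -> R).
  by move=> /ray_measurable h; exact: measurable_indic.
move=> /(_ _) cv.
have {}cv : \int[leb2]_(p in torus) (r p * (S n p.1 * T n p.2)) @[n --> \oo] -->
   \int[leb2]_(p in torus) (r p * (\1_A p.1 * \1_B p.2)).
  apply: cv.
  - move=> n; have [s hs] := hst n; apply: measurable_funM => //.
    rewrite (_ : (fun p => _) = mode_sum s); last by apply/funext => p; exact: hs.
    by apply: measurable_funTS; exact: mode_sum_measurable.
  - apply: measurable_funM => //; apply: measurable_funTS; apply: measurable_funM.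
      by apply: measurableT_comp; [exact: mi|exact: measurable_fst].
    by apply: measurableT_comp; [exact: mi|exact: measurable_snd].
  (* Convergence may fail only on the lines through the end points of the arcs, a null set. *)
  - exists ([set x : R | x = 0 \/ x = a] `*` setT `|` setT `*` [set x : R | x = 0 \/ x = b]).
    have m1 (c : R) : measurable ([set c] : set (measurableTypeR R)) by exact: measurable_set1.
    have m2 (c : R) : measurable ([set x : R | x = 0 \/ x = c] : set (measurableTypeR R)).
      rewrite (_ : [set x | _] = [set 0] `|` [set c])//.
      by apply: measurableU; exact: measurable_set1.
    have z2 (c : R) : lebesgue_measure ([set x : R | x = 0 \/ x = c]) = 0%E.
      rewrite (_ : [set x | _] = [set 0] `|` [set c])//.
      apply: null_set_setU; [exact: m1|exact: m1|exact: lebesgue_measure_set1|].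
      exact: lebesgue_measure_set1.
    pose Z (c : R) := [set x : R | x = 0 \/ x = c].
    have mT := @measurableT _ (measurableTypeR R).
    split.
    + by apply: measurableU; apply: measurableX.
    + apply: null_set_setU; try exact: measurableX.
        by rewrite /leb2; transitivity (lebesgue_measure (Z a) *
          lebesgue_measure [set: R])%E; [exact: product_measure1E|rewrite /Z z2 mul0e].
      by rewrite /leb2; transitivity (lebesgue_measure [set: R] *
        lebesgue_measure (Z b))%E;
        [exact: product_measure1E|rewrite /Z z2 mule0].
    + move=> p /= np; apply: contrapT => hp; apply: np => -[/= p1 p2].
      move: hp => /not_orP[h1 h2].
      have [/eqP n1 /eqP n2] : p.1 <> 0 /\ p.1 <> a by apply/not_orP => h; apply: h1.
      have [/eqP n3 /eqP n4] : p.2 <> 0 /\ p.2 <> b by apply/not_orP => h; apply: h2.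
      rewrite !in_itv /= in p1 p2.
      apply: cvgM; first exact: cvg_cst.
      by apply: cvgM; [exact: cS|exact: cT].
  - exact: integrable_norm ir.
  - move=> n p _; rewrite normrM ler_piMr//.
    have := S01 n p.1; have := T01 n p.2; move: (S _ _) (T _ _) => x y /andP[? ?] /andP[? ?].
    by rewrite ger0_norm; nra.
have : \int[leb2]_(p in torus) (r p * (S n p.1 * T n p.2)) @[n --> \oo] --> (0 : R).
  rewrite (_ : (fun n => _) = fun=> 0); first exact: cvg_cst.
  apply/funext => n; have [s hs] := hst n; rewrite -(r0 s) /torus_inner.
  by apply: eq_Rintegral => p _; rewrite hs.
by move=> /(cvg_unique _ cv) ->.
Qed.

(** A Dynkin class argument extends the vanishing of the integral of [r] from rectangles of
    half-lines to all measurable sets. *)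
Lemma fourier_complete (r : R * R -> R) : torus_integrable r -> (forall s,
    torus_inner r (mode_sum s) = 0) ->
  {ae leb2, forall p, torus p -> r p = 0}.
Proof.
move=> ir r0; have mt := @torus_measurable R.
have mr : measurable_fun (torus : set plane) (EFin \o r) by have /integrableP[] := ir.
pose P (A : set plane) := (\int[leb2]_(p in A `&` torus) (r p)%:E = 0)%E.
have PG A : ray_rects A -> P A.
  move=> [X rX [Y rY <-]]; rewrite /P.
  have mXY : measurable (X `*` Y : set plane) by apply: measurableX; exact: ray_measurable.
  rewrite setIC integral_mkcondr.
  have := torus_inner_indic ir r0 rX rY.
  rewrite /Rintegral => /eqP; rewrite fine_eq0; last first.
    apply: integrable_fin_num; first exact: mt.
    apply: (@torus_integrableM R r (fun p => \1_X p.1 * \1_Y p.2) ir).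
      apply: measurable_funTS; apply: measurable_funM; apply: measurableT_comp;
        rewrite /=; try (apply: measurable_indic; exact: ray_measurable).
        exact: measurable_fst.
      exact: measurable_snd.
    by exists 1 => p _; rewrite !indicE; do 2 case: (_ \in _);
       rewrite ?mulr0 ?mul0r ?mulr1 ?normr0 ?normr1.
  move=> /eqP <-; apply: eq_integral => -[p1 p2] _ /=.
  rewrite !indicE /patch.
  have -> : ((p1, p2) \in X `*` Y) = (p1 \in X) && (p2 \in Y).
    by apply/idP/andP; rewrite !inE.
  case: (p1 \in X); case: (p2 \in Y) => /=.
  - by rewrite !mulr1.
  - by rewrite !mulr0.
  - by rewrite mul0r mulr0.
  - by rewrite mul0r mulr0.
have PT : P setT by apply: PG; exists setT; [left|exists setT; [left|exact: setXTT]].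
have PA A : measurable (A : set plane) -> P A.
  rewrite ray_rects_gen; apply: (dynkin_induction ray_rects_gen ray_rects_setI PT PG).
  - move=> S mS; rewrite /P => hS; move: PT; rewrite /P setTI.
    have mST : measurable (S `&` torus : set plane) by apply: measurableI.
    have mST' : measurable (~` S `&` torus : set plane).
      by apply: measurableI => //; exact: measurableC.
    have tE : (torus : set plane) = (S `&` torus) `|` (~` S `&` torus).
      by rewrite -setIUl setUCr setTI.
    rewrite {1}tE integral_setU//; first by rewrite hS add0e.
    + by rewrite -tE.
    + by apply/disj_setPS => p [[? _] [? _]].
  - move=> F mF tF PF; rewrite /P setI_bigcupl integral_bigcup.
    + by rewrite eseries0// => i _ _; exact: PF.
    + exact: trivIset_setIr.
    + by move=> k; exact: measurableI.
    + rewrite -setI_bigcupl; apply: integrableS ir => //.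
      by apply: measurableI => //; exact: bigcupT_measurable.
have : ae_eq leb2 (torus : set plane) (EFin \o r) (cst 0%E).
  apply: integral_ae_eq => // X Xt mX.
  have := PA X mX; rewrite /P setIidl// => ->.
  by rewrite integral0.
by apply: filterS => p h pT; have /= [] := h pT.
Qed.

End Completeness.

(** * Integration by parts for piecewise constant images *)

Section GridFunctions.
Context {R : realType}.
Local Notation plane := (measurableTypeR R * measurableTypeR R)%type.

(** Links the topology to the product sigma-algebra: an open set is the union of the countably many
    rectangles with rational corners that it contains. *)
Lemma open_measurable_plane (U : set (R * R)) : open U -> measurable (U : set plane).
Proof.
move=> oU.
pose rect (i : (rat * rat) * (rat * rat)) : set plane :=
  `]ratr i.1.1, ratr i.1.2[ `*` `]ratr i.2.1, ratr i.2.2[.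
pose F i := [set p | rect i p /\ rect i `<=` U].
have -> : U = \bigcup_i F i.
  apply/seteqP; split => [p Up|p [i _ [ip iU]]]; last exact: iU.
  have /nbhs_ballP[e /= e0 he] : nbhs p U by exact: open_nbhs_nbhs.
  have [q1 h1] : exists q : rat, ratr q \in `]p.1 - e, p.1[ by apply: rat_in_itvoo; lra.
  have [q2 h2] : exists q : rat, ratr q \in `]p.1, p.1 + e[ by apply: rat_in_itvoo; lra.
  have [q3 h3] : exists q : rat, ratr q \in `]p.2 - e, p.2[ by apply: rat_in_itvoo; lra.
  have [q4 h4] : exists q : rat, ratr q \in `]p.2, p.2 + e[ by apply: rat_in_itvoo; lra.
  move: h1 h2 h3 h4; rewrite !in_itv /= => /andP[a1 a2] /andP[b1 b2] /andP[c1 c2] /andP[d1 d2].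
  exists ((q1, q2), (q3, q4)) => //; split.
    by split; rewrite /= in_itv /=; apply/andP.
  move=> q [/=]; rewrite !in_itv /= => /andP[u1 u2] /andP[v1 v2].
  by apply: he; split => /=; rewrite -ball_normE /= ltr_norml; apply/andP; split; lra.
apply: countable_bigcupT_measurable; first exact: countableP.
move=> i; have [h|h] := pselect (rect i `<=` U).
  rewrite (_ : F i = rect i); last by apply/seteqP; split => [p []|p].
  by apply: measurableX; exact: measurable_itv.
rewrite (_ : F i = set0); first exact: measurable0.
by apply/seteqP; split => [p []|p].
Qed.

Lemma continuous_measurable_plane (f : R * R -> R) : continuous f -> measurable_fun
    [set: plane] (f : plane -> R).
Proof.
move=> cf; apply: (measurability _ (RGenOInfty.measurableE R)).
move=> _ [_ [a ->] <-]; rewrite setTI; apply: open_measurable_plane.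
by move/continuousP : cf; apply; exact: interval_open.
Qed.

Lemma continuous_bounded_torus (f : R * R -> R) : continuous f ->
  exists M : R, forall p, torus p -> `|f p| <= M.
Proof.
move=> cf.
have cK : compact (`[0%R, 1%R]%classic `*` `[0%R, 1%R]%classic : set (R * R)).
  by apply: compact_setX; exact: segment_compact.
have := continuous_compact (continuous_subspaceT cf) cK.
move=> /compact_bounded[M [_ hM]]; exists (M + 1) => p [/= p1 p2].
apply: (hM (M + 1)); first by rewrite ltrDl.
exists p => //; split => /=; first exact: subset_itv_co_cc p1.
exact: subset_itv_co_cc p2.
Qed.

Local Notation mu := (@lebesgue_measure R).

Lemma continuous_integrable_unit (A : set R) (h : R ->
    R) : measurable (A : set (measurableTypeR R)) ->
  A `<=` `[0, 1[ -> continuous h -> mu.-integrable A (EFin \o h).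
Proof.
move=> mA A1 ch; apply: (@integrableS _ _ _ mu `[0, 1]) => //.
  by move=> x /A1; exact: subset_itv_co_cc.
apply: continuous_compact_integrable; first exact: segment_compact.
exact: continuous_subspaceT.
Qed.

Lemma integral_indicM (A : set R) (b : R) (h : R -> R) : measurable (A : set (measurableTypeR R)) ->
  A `<=` `[0, 1[ -> continuous h ->
  (\int[mu]_x (\1_A x * b * h x)%:E = (b * \int[mu]_(x in A) h x)%:E)%E.
Proof.
move=> mA A1 ch.
have i1 := continuous_integrable_unit mA A1 ch.
rewrite -(RintegralZl b mA i1).
rewrite /Rintegral fineK; last first.
  by apply: integrable_fin_num => //; exact: (integrableZl mA b i1).
rewrite [in RHS]integral_mkcond; apply: eq_integral => x _.
by rewrite /patch indicE; case: (x \in A); rewrite ?mul1r// !mul0r.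
Qed.

Lemma cell_integrable d (A B : set R) (g : R * R -> R) :
  measurable (A : set (measurableTypeR R)) -> measurable (B : set (measurableTypeR R)) ->
  continuous g ->
  torus_integrable (fun p => \1_A (axis_coord d p) * \1_B (axis_coord (~~ d) p) * g p).
Proof.
move=> mA mB cg; have [M hM] := continuous_bounded_torus cg.
apply: (@torus_integrable_bounded _ _ M).
- apply: measurable_funM; last exact: continuous_measurable_plane.
  have mi X : measurable (X : set (measurableTypeR R)) -> measurable_fun [set: R] (\1_X : R -> R).
    by move=> mX; exact: measurable_indic.
  have mp b : measurable_fun [set: plane] (axis_coord b : plane -> R).
    by case: b; [exact: measurable_fst|exact: measurable_snd].
  by apply: measurable_funM; [exact: measurableT_comp (mi _ mA) (mp d)|
    exact: measurableT_comp (mi _ mB) (mp (~~ d))].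
- move=> p pT; rewrite !normrM; apply: le_trans (hM _ pT).
  by rewrite ler_piMl// !indicE; do 2 case: (_ \in _); rewrite /= ?normr1 ?normr0 ?mulr1 ?mulr0.
Qed.

(** The indicators vanish off the torus, so the integral may be taken over the whole plane; the
    coordinate along [d] is integrated first. *)
Lemma fubini_rectangle d (A B : set R) (g : R * R -> R) :
  measurable (A : set (measurableTypeR R)) -> measurable (B : set (measurableTypeR R)) ->
  A `<=` `[0, 1[ -> B `<=` `[0, 1[ -> continuous g ->
  \int[leb2]_(p in torus) (\1_A (axis_coord d p) * \1_B (axis_coord (~~ d) p) * g p) =
  \int[mu]_(t in B) \int[mu]_(s in A) g (axis_point d s t).
Proof.
move=> mA mB A1 B1 cg.
pose f p := \1_A (axis_coord d p) * \1_B (axis_coord (~~ d) p) * g p.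
have fT : f \_ torus = f.
  apply/funext => p; rewrite /patch; case: ifPn => // /negP np; rewrite /f !indicE.
  have [pA|] := boolP (axis_coord d p \in A); last by rewrite !mul0r.
  have [pB|] := boolP (axis_coord (~~ d) p \in B); last by rewrite mulr0 mul0r.
  exfalso; apply: np; rewrite inE; move: pA pB; rewrite !inE => /A1 pA /B1 pB.
  by split; case: d pA pB {f}.
have fi : leb2.-integrable [set: plane] (EFin \o f).
  have := cell_integrable d mA mB cg; rewrite /torus_integrable integrable_mkcond;
      last exact: torus_measurable.
  by rewrite restrict_EFin -/f fT.
rewrite Rintegral_mkcond -/f fT [RHS]Rintegral_mkcond /Rintegral; congr fine.
case: d @f fT fi => f fT fi.
  rewrite -(integral21_prod_meas1 fi); apply: eq_integral => t _; rewrite /fubini_G /=.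
  rewrite [LHS](integral_indicM (\1_B t) mA A1 (@axis_point_continuous R true g t cg)).
  by rewrite /patch indicE; case: (t \in B); rewrite /= ?mul1r// mul0r.
rewrite -(integral12_prod_meas1 fi); apply: eq_integral => t _; rewrite /fubini_F /=.
rewrite [LHS](integral_indicM (\1_B t) mA A1 (@axis_point_continuous R false g t cg)).
by rewrite /patch indicE; case: (t \in B); rewrite /= ?mul1r// mul0r.
Qed.

Lemma ftc_itvco (a b : R) (F : R -> R) : a <= b -> (forall x : R, derivable F x (1 : R)) ->
  continuous (derive1 F) -> \int[mu]_(x in `[a, b[) derive1 F x = F b - F a.
Proof.
move=> ab dF cF'.
have cF : continuous F by move=> x; apply: differentiable_continuous; apply/derivable1_diffP.
have [->|ne] := eqVneq a b.
  by rewrite set_itvco0 Rintegral_set0 subrr.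
have lt : a < b by rewrite lt_neqAle ne.
rewrite Rintegral_itv_bndo_bndc; last first.
  apply: (@integrableS _ _ _ mu `[a, b]) => //; first exact: subset_itv_co_cc.
  apply: continuous_compact_integrable; first exact: segment_compact.
  exact: continuous_subspaceT.
have ftc : (\int[mu]_(x in `[a, b]) (derive1 F x)%:E = (F b)%:E - (F a)%:E)%E.
  apply: (continuous_FTC2 lt).
  - exact: continuous_subspaceT.
  - split => [t _||]; first exact: dF.
    + by apply: cvg_at_right_filter; exact: cF.
    + by apply: cvg_at_left_filter; exact: cF.
  - by move=> t _.
by rewrite /Rintegral ftc.
Qed.

(** The unfolded interval lies in [0, 2[, so the floor takes only the values 0 and 1 on it. *)
Lemma cyclic_itvE (a b : R) : 0 <= a < 1 -> 0 <= b < 1 ->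
  cyclic_itv a b = if b < a then `[a, 1[ `|` `[0, b[ else `[a, b[%classic.
Proof.
move=> /andP[a0 a1] /andP[b0 b1]; rewrite /cyclic_itv; case: ifPn => [ba|]; last first.
  rewrite -leNgt => ab; apply/seteqP; split => [_ [t /= + <-]|t /=];
      rewrite in_itv /= => /andP[h1 h2].
    rewrite (@floor_def _ t 0) ?subr0 ?in_itv /= ?h1//.
    by rewrite (le_trans a0 h1) /= (lt_trans h2).
  exists t; first by rewrite /= in_itv /= h1.
  by rewrite (@floor_def _ t 0) ?subr0//= (le_trans a0 h1) /= (lt_trans h2).
apply/seteqP; split => [_ [t /= + <-]|t /=].
  rewrite in_itv /= => /andP[h1 h2]; rewrite !in_itv /=.
  have [t1|t1] := ltP t 1.
    by left; rewrite (@floor_def _ t 0) ?subr0 ?h1//= t1 (le_trans a0 h1).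
  right; rewrite (@floor_def _ t 1); last by rewrite t1 /=; lra.
  by rewrite subr_ge0 t1 /=; lra.
case; rewrite /= in_itv /= => /andP[h1 h2].
  exists t; first by rewrite /= in_itv /= h1 /=; lra.
  by rewrite (@floor_def _ t 0) ?subr0//= h2 (le_trans a0 h1).
exists (1 + t); first by rewrite /= in_itv /=; lra.
rewrite (@floor_def _ (1 + t) 1); first by rewrite addrC addKr.
by apply/andP; split => /=; lra.
Qed.

Lemma cyclic_itv_measurable (a b : R) : 0 <= a < 1 -> 0 <= b < 1 ->
  measurable (cyclic_itv a b : set (measurableTypeR R)) /\ cyclic_itv a b `<=` `[0, 1[.
Proof.
move=> a01 b01; rewrite cyclic_itvE//; case/andP: a01 => a0 a1; case/andP: b01 => b0 b1.
case: ifPn => ba; split.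
- by apply: measurableU; exact: measurable_itv.
- by move=> t [] /=; rewrite !in_itv /= => /andP[h1 h2]; apply/andP; split; lra.
- exact: measurable_itv.
- by move=> t /=; rewrite !in_itv /= => /andP[h1 h2]; apply/andP; split; lra.
Qed.

(** If the interval wraps around, the boundary terms at 1 and at 0 cancel by periodicity. *)
Lemma ftc_cyclic_itv (a b : R) (F : R -> R) : 0 <= a < 1 -> 0 <= b < 1 ->
  (forall x : R, derivable F x (1 : R)) -> continuous (derive1 F) -> (forall x : R,
      F (x + 1) = F x) ->
  \int[mu]_(x in cyclic_itv a b) derive1 F x = F b - F a.
Proof.
move=> a01 b01 dF cF pF; rewrite cyclic_itvE//; have := a01; have :=
    b01 => /andP[b0 b1] /andP[a0 a1].
case: ifPn => [ba|]; last by rewrite -leNgt => ab; exact: ftc_itvco.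
rewrite Rintegral_setU.
- rewrite !ftc_itvco//; last exact: ltW.
  by have := pF 0; rewrite add0r => ->; ring.
- exact: measurable_itv.
- exact: measurable_itv.
- apply: continuous_integrable_unit => //; first by apply: measurableU; exact: measurable_itv.
  by move=> t [] /=; rewrite !in_itv /= => /andP[h1 h2]; apply/andP; split; lra.
- by apply/disj_setPS => t [] /=; rewrite !in_itv /= => /andP[h1 h2] /andP[h3 h4]; lra.
Qed.

Lemma smooth_axis_partial d (phi : R * R -> R) : smooth_torus phi ->
    continuous phi /\ continuous (axis_partial d phi).
Proof.
move=> [/(_ 1%N) /= [c0 [_ _ [cx _] [cy _]]] _]; split => //.
by case: d.
Qed.

Lemma smooth_derivable d (phi : R * R -> R) s t : smooth_torus phi ->
  derivable (fun s => phi (axis_point d s t)) s (1 : R).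
Proof.
move=> [/(_ 1%N) /= [c0 [dx dy _ _]] _]; case: d; first exact: (dx (s, t)).
exact: (dy (t, s)).
Qed.

Lemma smooth_periodic d (phi : R * R -> R) s t : smooth_torus phi ->
    phi (axis_point d (s + 1) t) = phi (axis_point d s t).
Proof. by move=> [_ h]; case: d; [have [] := h s t|have [] := h t s]. Qed.

Definition line_integral d (phi : R * R -> R) (a : R) (B : set R) : R :=
  \int[mu]_(t in B) phi (axis_point d a t).

Lemma line_integrable d phi a (B : set R) : measurable (B : set (measurableTypeR R)) ->
  B `<=` `[0, 1[ -> continuous phi -> mu.-integrable B (EFin \o (fun t => phi (axis_point d a t))).
Proof.
move=> mB B1 cphi; apply: continuous_integrable_unit => //.
have := @axis_point_continuous R (~~ d) phi a cphi.
by rewrite /axis_point; case: d.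
Qed.

Lemma integral_cell d a b (B : set R) phi : 0 <= a < 1 -> 0 <= b < 1 ->
  measurable (B : set (measurableTypeR R)) -> B `<=` `[0, 1[ -> smooth_torus phi ->
  \int[leb2]_(p in torus) (\1_(cyclic_itv a b) (axis_coord d p) * \1_B (axis_coord (~~ d) p) *
      axis_partial d phi p) =
  line_integral d phi b B - line_integral d phi a B.
Proof.
move=> a01 b01 mB B1 sphi; have [cphi cpd] := smooth_axis_partial d sphi.
have [mA A1] := cyclic_itv_measurable a01 b01.
rewrite fubini_rectangle// /line_integral -RintegralB//; [|exact: line_integrable..].
apply: eq_Rintegral => t _.
rewrite -(@ftc_cyclic_itv a b (fun s => phi (axis_point d s t)))//.
- by apply: eq_Rintegral => s _; rewrite axis_partialE.
- by move=> s; exact: smooth_derivable.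
- rewrite (_ : derive1 _ = fun s => axis_partial d phi (axis_point d s t)).
    exact: axis_point_continuous.
  by apply/funext => s; rewrite axis_partialE.
- by move=> s; exact: smooth_periodic.
Qed.

Lemma Rintegral_sum_seq (I : Type) (r : seq I) (F : I -> R * R -> R) :
  (forall i, torus_integrable (F i)) ->
  torus_integrable (fun p => \sum_(i <- r) F i p) /\
  \int[leb2]_(p in torus) (\sum_(i <- r) F i p) = \sum_(i <- r) \int[leb2]_(p in torus) F i p.
Proof.
move=> iF; have hm := @torus_measurable R; elim: r => [|i r [IH1 IH2]].
  rewrite big_nil (_ : (fun p => _) = fun=> 0); last by apply/funext => p; rewrite big_nil.
  split; last by rewrite Rintegral_cst ?mul0r.
  by rewrite /torus_integrable (_ : _ \o _ = cst 0%E)//; exact: integrable0.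
rewrite (_ : (fun p => _) = (fun p => F i p + \sum_(i <- r) F i p)); last first.
  by apply/funext => p; rewrite big_cons.
by split; [exact: torus_integrableD|rewrite [LHS](RintegralD hm (iF i) IH1) IH2 big_cons].
Qed.

(** * Variation of a piecewise constant image along one axis *)

Section Image.
Variables (d : bool) (M N : nat) (x : 'I_M.+1 -> R) (y : 'I_N.+1 -> R) (c : 'M[R]_(M.+1, N.+1)).
Hypothesis x01 : forall m, 0 <= x m < 1.
Hypothesis y01 : forall n, 0 <= y n < 1.

(** The image with its first index along the axis [d], so that one argument serves both directions;
    for the vertical axis the nodes are exchanged and [c] is transposed. *)
Definition grid_fun (p : R * R) : R := \sum_(m < M.+1) \sum_(n < N.+1)
  c m n * (\1_(cyclic_itv (x m) (x (ordS m))) (axis_coord d p) *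
           \1_(cyclic_itv (y n) (y (ordS n))) (axis_coord (~~ d) p)).

Definition jump m n : R := c m n - c (ord_pred m) n.

Local Notation strip n := (cyclic_itv (y n) (y (ordS n))).

Lemma integral_grid_fun (g : R * R -> R) : continuous g ->
  torus_integrable (fun p => grid_fun p * g p) /\
  \int[leb2]_(p in torus) (grid_fun p * g p) = \sum_(m < M.+1) \sum_(n < N.+1) c m n *
   \int[leb2]_(p in torus) (\1_(cyclic_itv (x m) (x (ordS m))) (axis_coord d p) *
           \1_(strip n) (axis_coord (~~ d) p) * g p).
Proof.
move=> cg; rewrite (_ : (fun p => _) = (fun p => \sum_(m < M.+1) \sum_(n < N.+1)
  c m n * (\1_(cyclic_itv (x m) (x (ordS m))) (axis_coord d p) * \1_(strip n) (axis_coord (~~ d)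
      p) * g p))); last first.
  apply/funext => p; rewrite /grid_fun mulr_suml; apply: eq_bigr => m _.
  by rewrite mulr_suml; apply: eq_bigr => n _; rewrite !mulrA.
have hm := @torus_measurable R.
have cI m n : torus_integrable (fun p => \1_(cyclic_itv (x m) (x (ordS m))) (axis_coord d p) *
    \1_(strip n) (axis_coord (~~ d) p) * g p).
  by apply: cell_integrable => //; [case: (cyclic_itv_measurable (x01 m) (x01 (ordS m)))|
     case: (cyclic_itv_measurable (y01 n) (y01 (ordS n)))].
have inner m := @Rintegral_sum_seq _ (index_enum 'I_N.+1) (fun n p =>
   c m n * (\1_(cyclic_itv (x m) (x (ordS m))) (axis_coord d p) *
    \1_(strip n) (axis_coord (~~ d) p) * g p)) (fun n => torus_integrableZ (c m n) (cI m n)).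
have [h1 h2] := Rintegral_sum_seq (index_enum 'I_M.+1) (fun m => (inner m).1).
split => //; rewrite h2; apply: eq_bigr => m _; rewrite (inner m).2; apply: eq_bigr => n _.
exact: (RintegralZl (c m n) hm (cI m n)).
Qed.

(** Each cell yields the difference of its two edge integrals. Reindexing by the cyclic predecessor,
    an Abel summation, gathers the two contributions to each line into a jump. *)
Lemma grid_fun_by_parts phi : smooth_torus phi ->
  torus_inner grid_fun (axis_partial d phi) =
      - \sum_(m < M.+1) \sum_(n < N.+1) jump m n * line_integral d phi (x m) (strip n).
Proof.
move=> sphi; have [cphi cpd] := smooth_axis_partial d sphi.
have [_] := integral_grid_fun cpd; rewrite -/(torus_inner grid_fun (axis_partial d phi)) => ->.
rewrite exchange_big /= [in RHS]exchange_big /= -sumrN; apply: eq_bigr => n _.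
have [mB B1] := cyclic_itv_measurable (y01 n) (y01 (ordS n)).
rewrite (eq_bigr (fun m => c m n * line_integral d phi (x (ordS m)) (strip n) - c m n *
    line_integral d phi (x m) (strip n))).
  rewrite sumrB (reindex_inj (can_inj (@ord_predK M.+1))) /=.
  rewrite -sumrB -sumrN; apply: eq_bigr => m _.
  by rewrite ord_predK /jump; ring.
by move=> m _; rewrite integral_cell// mulrBr.
Qed.

Definition strip_len n : R := \int[mu]_(t in strip n) 1.

Definition grid_variation : R := \sum_(m < M.+1) \sum_(n < N.+1) `|jump m n| * strip_len n.

Lemma grid_fun_partial_le phi : smooth_torus phi -> (forall p, `|phi p| <= 1) ->
  torus_inner grid_fun (axis_partial d phi) <= grid_variation.
Proof.
move=> sphi p1; rewrite grid_fun_by_parts// -sumrN; apply: ler_sum => m _.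
rewrite -sumrN; apply: ler_sum => n _.
have [mB B1] := cyclic_itv_measurable (y01 n) (y01 (ordS n)).
have [cphi _] := smooth_axis_partial d sphi.
have li := line_integrable d (x m) mB B1 cphi.
apply: le_trans (ler_norm _) _; rewrite normrN normrM; apply: ler_wpM2l => //.
rewrite /line_integral; apply: le_trans (le_normr_Rintegral mB li) _.
apply: le_Rintegral => //.
- exact: (integrable_norm li).
- by apply: (@continuous_integrable_unit _ (fun=> 1)) => // t; exact: cvg_cst.
Qed.

(** The value [- sg m] on the line offsets the minus sign of the integration by parts, so the upper
    bound of [grid_fun_partial_le] is attained. *)
Lemma grid_fun_partial_eq (f : R -> R) (sg : 'I_M.+1 -> R) :
  smooth_torus (fun p => f (axis_coord d p)) ->
  (forall m, f (x m) = - sg m) ->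
  (forall m n, sg m * jump m n = `|jump m n|) ->
  torus_inner grid_fun (axis_partial d (fun p => f (axis_coord d p))) = grid_variation.
Proof.
move=> sf fx sgj; rewrite grid_fun_by_parts// -sumrN; apply: eq_bigr => m _.
rewrite -sumrN; apply: eq_bigr => n _.
have [mB B1] := cyclic_itv_measurable (y01 n) (y01 (ordS n)).
rewrite -sgj /line_integral.
have -> : \int[mu]_(t in strip n) f (axis_coord d (axis_point d (x m) t)) =
    \int[mu]_(t in strip n) (f (x m) * 1).
  by apply: eq_Rintegral => t _; rewrite mulr1; case: d.
rewrite RintegralZl//; last by apply: (@continuous_integrable_unit _ (fun=> 1)) => // t;
    exact: cvg_cst.
by rewrite fx /strip_len; ring.
Qed.

End Image.

End GridFunctions.

(** * Signs of the jumps *)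

Section JumpSigns.
Context {R : realType}.
Local Notation plane := (measurableTypeR R * measurableTypeR R)%type.
Local Notation mu := (@lebesgue_measure R).

Lemma cvg_sum_fin (I : finType) (f : I -> nat -> R) (a : I -> R) :
  (forall i, f i k @[k --> \oo] --> a i) -> \sum_i f i k @[k --> \oo] --> \sum_i a i.
Proof.
move=> fa; elim: (index_enum I) => [|i s IH].
  rewrite big_nil (_ : (fun k => _) = fun=> 0); first exact: cvg_cst.
  by apply/funext => k; rewrite big_nil.
rewrite big_cons (_ : (fun k => _) = (fun k => f i k + \sum_(i <- s) f i k)); first exact: cvgD.
by apply/funext => k; rewrite big_cons.
Qed.

Lemma cvg_ge0 (f : nat -> R) (l : R) : f i @[i --> \oo] --> l -> (forall i, 0 <= f i) -> 0 <= l.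
Proof.
move=> fl f0; rewrite -(cvg_lim (@Rhausdorff R) fl); apply: limr_ge.
  by apply/cvg_ex; exists l.
exact: nearW.
Qed.

Lemma cvg_le0 (f : nat -> R) (l : R) : f i @[i --> \oo] --> l -> (forall i, f i <= 0) -> l <= 0.
Proof.
move=> fl f0; rewrite -(cvg_lim (@Rhausdorff R) fl); apply: limr_le.
  by apply/cvg_ex; exists l.
exact: nearW.
Qed.

Definition edge_line (d : bool) (a : R) : set plane :=
  if d then [set a] `*` `[0, 1[ else `[0, 1[ `*` [set a].

Lemma edge_lineP d a p : edge_line d a p <-> axis_coord d p = a /\ 0 <= axis_coord (~~ d) p < 1.
Proof. by case: d; rewrite /edge_line /= ?in_itv /=; tauto. Qed.

Lemma edge_line_measurable d a : measurable (edge_line d a).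
Proof.
by case: d; apply: measurableX; try exact: measurable_itv; exact: measurable_set1.
Qed.

(** This is cos (pi t)^2; its powers concentrate at the integers. *)
Definition bump (t : R) : R := 1 / 2 + (1 / 2) * cos (2 * pi * t).

Lemma trig_poly_bump a k : exists d, trig_poly d (fun t => bump (t - a) ^+ k).
Proof.
exists (k * 1)%N; apply: trig_poly_exp.
apply: (@trig_poly_shift R 1 bump a); apply: trig_polyD; first exact: trig_poly_const.
by apply: trig_polyZ; exact: trig_poly_cos.
Qed.

Lemma bump01 t : 0 <= bump t <= 1.
Proof. by have := cos_le1 (2 * pi * t); have := cos_geN1 (2 * pi * t); rewrite /bump; lra. Qed.

Lemma bump_lt1 (t a : R) : 0 <= t < 1 -> 0 <= a < 1 -> t != a -> bump (t - a) < 1.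
Proof.
move=> /andP[t0 t1] /andP[a0 a1] ta.
have s : 0 < sin (pi * `|t - a|).
  have d0 : 0 < `|t - a| by rewrite normr_gt0 subr_eq0.
  have d1 : `|t - a| < 1 by rewrite ltr_norml; apply/andP; split; lra.
  have pi0 := pi_gt0 R; apply: sin_gt0_pi; rewrite mulr_gt0//=.
  by rewrite -[X in _ < X]mulr1 ltr_pM2l.
have e : cos (2 * pi * (t - a)) = 1 - 2 * sin (pi * `|t - a|) ^+ 2.
  have -> : cos (2 * pi * (t - a)) = cos ((pi * `|t - a|) *+ 2).
    rewrite -[LHS]cos_norm; congr cos.
    by rewrite !normrM (ger0_norm (pi_ge0 R)) (ger0_norm (ler0n R 2)) -[RHS]mulr_natl mulrA.
  by rewrite cos_mulr2n cos2sin2; ring.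
by rewrite /bump e; have := exprn_gt0 2 s; lra.
Qed.

Lemma bump_cvg (t a : R) : 0 <= t < 1 -> 0 <= a < 1 ->
  bump (t - a) ^+ k @[k --> \oo] --> ((t == a)%:R : R).
Proof.
move=> t01 a01; have [->|ta] := eqVneq t a.
  rewrite subrr (_ : (fun k => _) = fun=> 1); first exact: cvg_cst.
  by apply/funext => k; rewrite /bump mulr0 cos0 mulr1 -mulrDl divff ?expr1n.
have /andP[b0 b1] := bump01 (t - a).
by apply: cvg_expr; rewrite ger0_norm// bump_lt1.
Qed.

Lemma trig_poly_prod_axis d n n' (f g : R -> R) : trig_poly n f -> trig_poly n' g ->
  exists s, (fun p => f (axis_coord d p) * g (axis_coord (~~ d) p)) = mode_sum s.
Proof.
move=> lf lg; case: d.
  by have [s hs] := trig_poly_prod lf lg; exists s; apply/funext => p; rewrite -hs.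
by have [s hs] := trig_poly_prod lg lf; exists s; apply/funext => p; rewrite -hs mulrC.
Qed.

Lemma trig_poly_bound n (f : R -> R) : trig_poly n f -> exists M, forall t, `|f t| <= M.
Proof.
move=> /trig_poly_x[s hs]; have [M hM] := mode_sum_bounded s.
by exists M => t; rewrite (hs (t, 0)).
Qed.

Lemma torus_axis_coord d (p : R * R) : torus p -> 0 <= (axis_coord d p : R) < 1.
Proof. by case; rewrite /= !in_itv /=; case: d. Qed.

(** * Restriction of a signed measure to a line, as a limit of smooth tests *)

Section ChargeLim.
Variables (d : bool) (a : R) (n : nat) (S : R -> R).
Hypothesis a01 : 0 <= a < 1.
Hypothesis lS : trig_poly n S.
Hypothesis S0 : forall t, 0 <= S t.

Definition edge_test k (p : R * R) : R := bump (axis_coord d p - a) ^+ k * S (axis_coord (~~ d) p).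
Definition edge_limit (p : R * R) : R := (axis_coord d p == a)%:R * S (axis_coord (~~ d) p).

Lemma edge_test_mode_sum k : exists s, edge_test k = mode_sum s.
Proof. by have [n' ln] := trig_poly_bump a k; exact: trig_poly_prod_axis ln lS. Qed.

Lemma edge_limit_measurable : measurable_fun (torus : set plane) edge_limit.
Proof.
have [s hs] := trig_poly_prod_axis d (trig_poly_const 0 (1 : R)) lS.
rewrite (_ : edge_limit = fun p => \1_[set a] (axis_coord d p) * mode_sum s p); last first.
  apply/funext => p; rewrite -hs mul1r /edge_limit indicE; congr (_%:R * _); congr nat_of_bool.
  by apply/eqP/idP; rewrite inE.
apply: measurable_funTS; apply: measurable_funM; last exact: mode_sum_measurable.
have mp b : measurable_fun [set: plane] (axis_coord b : plane -> R).
  by case: b; [exact: measurable_fst|exact: measurable_snd].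
apply: measurableT_comp (mp d); apply: measurable_indic; exact: measurable_set1.
Qed.

Lemma integral_edge_test_cvg (m : {finite_measure set plane -> \bar R}) :
  \int[m]_(p in torus) edge_test k p @[k --> \oo] --> \int[m]_(p in torus) edge_limit p.
Proof.
have [M hM] := trig_poly_bound lS.
apply: (@dominated_cvg_Rintegral _ _ _ m torus edge_test edge_limit (fun=> M)).
- exact: torus_measurable.
- by move=> k; have [s ->] := edge_test_mode_sum k; apply: measurable_funTS;
    exact: mode_sum_measurable.
- exact: edge_limit_measurable.
- apply: aeW => p pT; apply: cvgM; last exact: cvg_cst.
  by apply: bump_cvg => //; exact: torus_axis_coord.
- apply: (@integrableS _ _ _ m setT) => //; first exact: torus_measurable.
  exact: finite_measure_integrable_cst.
- move=> k p _; rewrite /edge_test normrM; apply: le_trans (hM (axis_coord (~~ d) p)).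
  have /andP[b0 b1] := bump01 (axis_coord d p - a).
  by rewrite ler_piMl// ger0_norm ?exprn_ge0// exprn_ile1.
Qed.

Lemma integral_edge_limit_null (m : {finite_measure set plane -> \bar R}) :
  m (edge_line d a) = 0%E -> \int[m]_(p in torus) edge_limit p = 0.
Proof.
move=> m0.
have -> : \int[m]_(p in torus) edge_limit p =
    \int[m]_(p in torus) (edge_limit \_ (edge_line d a)) p.
  apply: eq_Rintegral => p; rewrite inE => pT; rewrite /patch; case: ifPn => // /negP np.
  rewrite /edge_limit; case: eqP => [e|]; last by rewrite mul0r.
  by exfalso; apply: np; rewrite inE; apply/edge_lineP; split => //; exact: torus_axis_coord.
rewrite -Rintegral_mkcondr /Rintegral null_set_integral//.
- by apply: measurableI; [exact: torus_measurable|exact: edge_line_measurable].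
- by apply/measurable_EFinP; apply: measurable_funS edge_limit_measurable => //;
    exact: torus_measurable.
- apply: (subset_measure0 (B := edge_line d a)) => //.
  + by apply: measurableI; [exact: torus_measurable|exact: edge_line_measurable].
  + exact: edge_line_measurable.
Qed.

Lemma integral_edge_limit_ge0 (m : {finite_measure set plane ->
    \bar R}) : 0 <= \int[m]_(p in torus) edge_limit p.
Proof. by apply: Rintegral_ge0 => p _; rewrite /edge_limit mulr_ge0. Qed.

(** Both Jordan parts are finite measures, so each integral converges. On a positive line the
    negative part has no mass, being minus [nu] on the intersection with the negative Hahn set; only
    a nonnegative integral remains. The other case is symmetric. *)
Lemma charge_edge_test_cvg (nu : {charge set plane -> \bar R}) : exists l : R,
  [/\ charge_integral nu torus (edge_test k) @[k --> \oo] --> l,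
   nu.-positive_set (edge_line d a) -> 0 <= l & nu.-negative_set (edge_line d a) -> l <= 0].
Proof.
rewrite /charge_integral; case: cid => P hP; case: cid => N nuPN.
have ml := edge_line_measurable d a.
exists (\int[jordan_pos nuPN]_(p in torus) edge_limit p - \int[jordan_neg nuPN]_(p in torus)
    edge_limit p).
split.
- by apply: cvgB; exact: integral_edge_test_cvg.
- move=> [_ pos].
  have n0 : jordan_neg nuPN (edge_line d a) = 0%E.
    apply/eqP; rewrite eq_le measure_ge0 andbT jordan_negE cjordan_negE /crestr0 mem_set//.
    rewrite /crestr /= oppe_le0; apply: pos; last exact: subIsetl.
    by apply: measurableI => //; case: nuPN => _ [].
  by rewrite (integral_edge_limit_null n0) subr0; exact: integral_edge_limit_ge0.
- move=> [_ neg].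
  have n0 : jordan_pos nuPN (edge_line d a) = 0%E.
    apply/eqP; rewrite eq_le measure_ge0 andbT jordan_posE cjordan_posE /crestr0 mem_set//.
    rewrite /crestr /=; apply: neg; last exact: subIsetl.
    by apply: measurableI => //; case: nuPN => [[]].
  by rewrite (integral_edge_limit_null n0) sub0r oppr_le0; exact: integral_edge_limit_ge0.
Qed.

End ChargeLim.

(** * From the sign of the measure on a line to the signs of the jumps *)

Section JumpSign.
Variables (d : bool) (M N : nat) (x : 'I_M.+1 -> R) (y : 'I_N.+1 -> R) (c : 'M[R]_(M.+1, N.+1)).
Hypothesis x01 : forall m, 0 <= x m < 1.
Hypothesis y01 : forall n, 0 <= y n < 1.
Hypothesis xinj : injective x.
Hypothesis yinc : forall n n' : 'I_N.+1, (n < n')%N -> y n < y n'.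
Hypothesis N0 : (0 < N)%N.
Variable nu : {charge set plane -> \bar R}.
Hypothesis hnu : is_distr_deriv (axis_partial d) (grid_fun d x y c) nu.

Local Notation strip n := (cyclic_itv (y n) (y (ordS n))).

(** The same limit is computed twice: the measure gives its sign, and integration by parts gives its
    value, since the powers of [bump] keep only the line [x m]. *)
Lemma jump_weighted_sign n (S : R -> R) m : trig_poly n S -> (forall t, 0 <= S t) ->
  let s := \sum_(k < N.+1) jump c m k * \int[mu]_(t in strip k) S t in
  (nu.-positive_set (edge_line d (x m)) -> 0 <= s) /\
  (nu.-negative_set (edge_line d (x m)) -> s <= 0).
Proof.
move=> lS S0 s; have [l [cl lpos lneg]] := charge_edge_test_cvg d (x01 m) lS S0 nu.
suff : charge_integral nu torus (edge_test d (x m) S k) @[k --> \oo] --> s.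
  by move=> /(cvg_unique _ cl) <-.
have e k : charge_integral nu torus (edge_test d (x m) S k) = \sum_(i < M.+1)
    bump (x i - x m) ^+ k * \sum_(j < N.+1) jump c i j * \int[mu]_(t in strip j) S t.
  have [q hq] := edge_test_mode_sum d (x m) lS k.
  have sq : smooth_torus (edge_test d (x m) S k) by rewrite hq; exact: mode_sum_smooth.
  have := hnu sq; rewrite -/(torus_inner _ _) grid_fun_by_parts// => /oppr_inj <-.
  apply: eq_bigr => i _; rewrite mulr_sumr; apply: eq_bigr => j _.
  have [mB B1] := cyclic_itv_measurable (y01 j) (y01 (ordS j)).
  rewrite mulrCA; congr (_ * _); rewrite /line_integral.
  have iS : mu.-integrable (strip j) (EFin \o S) by apply: continuous_integrable_unit => //;
      exact: trig_poly_cont lS.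
  rewrite -(RintegralZl _ mB iS); apply: eq_Rintegral => t _.
  by rewrite /edge_test /axis_point /axis_coord; case: d.
rewrite (_ : (fun k => _) = (fun k => \sum_(i < M.+1)
    bump (x i - x m) ^+ k * \sum_(j < N.+1) jump c i j * \int[mu]_(t in strip j) S t)); last first.
  by apply/funext.
have -> : s = \sum_(i < M.+1) (x i == x m)%:R *
    \sum_(j < N.+1) jump c i j * \int[mu]_(t in strip j) S t.
  rewrite (bigD1 m)//= eqxx mul1r [X in _ + X]big1 ?addr0// => i im.
  by rewrite (inj_eq xinj) (negbTE im) mul0r.
apply: cvg_sum_fin => i; apply: cvgM; last exact: cvg_cst.
exact: bump_cvg.
Qed.

Lemma strip_contains_arc (n : 'I_N.+1) : exists b, [/\ y n < b, b < 1 &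
  forall k, strip k `&` `]y n, b[ = if k == n then `]y n, b[%classic else set0].
Proof.
have ymono (i j : 'I_N.+1) : (i <= j)%N -> y i <= y j.
  rewrite leq_eqVlt => /orP[/eqP/val_inj ->//|/yinc]; exact: ltW.
have nextE (i : 'I_N.+1) : (i < N)%N -> ordS i = i.+1 :> nat.
  by move=> iN; rewrite /= modn_small.
have lastE (i : 'I_N.+1) : (N <= i)%N -> ordS i = ord0.
  move=> Ni; apply/val_inj => /=; have -> : i = N :> nat by have := ltn_ord i; lia.
  by rewrite modnn.
have BE (k : 'I_N.+1) t : strip k t <-> if (k < N)%N then y k <= t < y (ordS k)
    else (y k <= t < 1) || (0 <= t < y ord0).
  rewrite cyclic_itvE//; have [kN|Nk] := ltnP k N.
    have lt : y k < y (ordS k) by apply: yinc; rewrite nextE.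
    by rewrite ltNge (ltW lt) /= in_itv.
  have -> : y (ordS k) < y k by rewrite lastE//; apply: yinc => /=; lia.
  rewrite lastE//; split => [[] /=|/orP[] h]; rewrite ?in_itv /=.
  - by move=> ->.
  - by move=> ->; rewrite orbT.
  - by left; rewrite /= in_itv.
  - by right; rewrite /= in_itv.
(* The last strip wraps around 0; halving the distance from [y n] to 1 keeps the arc strictly inside
   [0, 1[, as [arc_approx] requires. *)
pose b := if (n < N)%N then y (ordS n) else (y n + 1) / 2.
have := y01 n => /andP[yn0 yn1].
have nb : y n < b.
  by rewrite /b; case: ltnP => h; [apply: yinc; rewrite nextE|lra].
have b1 : b < 1 by rewrite /b; case: ltnP => h; [case/andP: (y01 (ordS n))|lra].
exists b; split => // k; apply/seteqP; split => t.
  move=> [/BE hk]; rewrite /= in_itv /= => /andP[h1 h2].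
  have [kn|kn] := eqVneq k n; first by rewrite /= in_itv /= h1 h2.
  exfalso; move: hk; have [kN|Nk] := ltnP k N.
    move=> /andP[h3 h4]; have [lt|gt|e] := ltngtP k n.
    - have : y (ordS k) <= y n by apply: ymono; rewrite nextE.
      by rewrite leNgt (lt_trans h1 h4).
    - have bE : b = y (ordS n) by rewrite /b (ltn_trans gt kN).
      have : y (ordS n) <= y k by apply: ymono; rewrite nextE// (ltn_trans gt kN).
      by rewrite -bE leNgt (le_lt_trans h3 h2).
    - by move/eqP: kn; apply; exact: val_inj.
  have nN : (n < N)%N.
    rewrite ltnNge; apply: contra kn => Nn; apply/eqP/val_inj => /=.
    by have := ltn_ord k; have := ltn_ord n; lia.
  have bE : b = y (ordS n) by rewrite /b nN.
  move=> /orP[] /andP[h3 h4].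
    have : y (ordS n) <= y k by apply: ymono; rewrite nextE//; lia.
    by rewrite -bE leNgt (le_lt_trans h3 h2).
  have : y ord0 <= y n by exact: ymono.
  by rewrite leNgt (lt_trans h1 h4).
case: eqVneq => [->|//]; rewrite /= in_itv /= => /andP[h1 h2]; split; last by rewrite h1.
apply/BE; rewrite /b in h2; case: ltnP h2 => nN h2; first by rewrite ltW.
by rewrite (ltW h1) (lt_trans h2)//; lra.
Qed.

(** Weights that tend to the indicator of an arc inside the strip [n] leave this single jump, times
    the positive length [b - y n]. *)
Lemma jump_edge_sign m (n : 'I_N.+1) :
  (nu.-positive_set (edge_line d (x m)) -> 0 <= jump c m n) /\
  (nu.-negative_set (edge_line d (x m)) -> jump c m n <= 0).
Proof.
have [b [nb b1 hB]] := strip_contains_arc n; have /andP[yn0 yn1] := y01 n.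
have [S [lS S01 cS]] := arc_approx yn0 nb b1.
pose arc := `]y n, b[%classic : set R.
have marc : measurable (arc : set (measurableTypeR R)) by exact: measurable_itv.
have lim k : \int[mu]_(t in strip k) S i t @[i --> \oo] --> ((k == n)%:R * (b - y n) : R).
  have [mB B1] := cyclic_itv_measurable (y01 k) (y01 (ordS k)).
  have -> : (k == n)%:R * (b - y n) = \int[mu]_(t in strip k) \1_arc t.
    have -> : \int[mu]_(t in strip k) \1_arc t = \int[mu]_(t in strip k) ((cst (1 : R)) \_ arc) t.
      by apply: eq_Rintegral => t _; rewrite indicE /patch; case: (_ \in _).
    rewrite -Rintegral_mkcondr hB; case: eqVneq => _; last by rewrite Rintegral_set0 mul0r.
    rewrite Rintegral_cst//= lebesgue_measure_itv /= lte_fin nb !mul1r.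
    by [].
  apply: (@dominated_cvg_Rintegral _ _ _ mu (strip k) S (\1_arc) (fun=> 1)) => //.
  - move=> i; have [q lq] := lS i; apply: measurable_funTS.
    by apply: continuous_measurable_fun; exact: trig_poly_cont lq.
  - exists [set y n; b]; split.
    + by apply: measurableU; exact: measurable_set1.
    + have m1 (e : R) : measurable ([set e] : set (measurableTypeR R)) by exact: measurable_set1.
      apply: null_set_setU; [exact: m1|exact: m1|exact: lebesgue_measure_set1|].
      exact: lebesgue_measure_set1.
    + move=> t /= nt; apply: contrapT => ht; apply: nt => Bt.
      have t01 := B1 _ Bt; rewrite /= in_itv /= in t01.
      move/not_orP: ht => [/eqP h1 /eqP h2].
      have := cS t t01 h1 h2; rewrite indicE (_ : (t \in arc) = (y n < t) && (t < b))//.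
      by apply/idP/idP; rewrite inE /arc /= in_itv.
  - by apply: (@continuous_integrable_unit _ _ (fun=> 1)) => // t; exact: cvg_cst.
  - by move=> i t _; have := S01 i t => /andP[h1 h2]; rewrite ger0_norm.
have cs : \sum_(k < N.+1) jump c m k * \int[mu]_(t in strip k) S i t @[i --> \oo] -->
    jump c m n * (b - y n).
  have -> : jump c m n * (b - y n) = \sum_(k < N.+1) jump c m k * ((k == n)%:R * (b - y n)).
    rewrite (bigD1 n)//= eqxx mul1r big1 ?addr0// => k kn.
    by rewrite (negbTE kn) mul0r mulr0.
  by apply: cvg_sum_fin => k; apply: cvgM; [exact: cvg_cst|exact: lim].
have S0 i t : 0 <= S i t by have /andP[] := S01 i t.
have bp : 0 < b - y n by rewrite subr_gt0.
split => h.
- rewrite -(pmulr_lge0 _ bp); apply: (cvg_ge0 cs) => i.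
  by have [q lq] := lS i; have [+ _] := jump_weighted_sign m lq (S0 i); apply.
- rewrite -(pmulr_lle0 _ bp); apply: (cvg_le0 cs) => i.
  by have [q lq] := lS i; have [_ +] := jump_weighted_sign m lq (S0 i); apply.
Qed.

(** A sign is attached to every line, even one without jumps, because [certificate] interpolates
    values of square 1. *)
Lemma jump_sign : (forall m, signed_on nu (edge_line d (x m))) ->
  exists2 sg : 'I_M.+1 -> R, (forall m, sg m ^+ 2 = 1) &
    forall m n, sg m * jump c m n = `|jump c m n|.
Proof.
move=> hs.
exists (fun m => if `[< nu.-positive_set (edge_line d (x m)) >] then 1 else -1).
  by move=> m; case: asboolP => _; rewrite ?sqrrN expr1n.
move=> m n; have [hp hn] := jump_edge_sign m n; case: asboolP => h.
  by rewrite mul1r ger0_norm// hp.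
by case: (hs m) => // /hn h0; rewrite mulN1r ler0_norm.
Qed.

End JumpSign.

End JumpSigns.

(** * Duality and stationarity *)

Section Duality.
Context {R : realType}.
Local Notation plane := (measurableTypeR R * measurableTypeR R)%type.

Lemma L2_torus_bounded (f : R * R -> R) (B : R) : measurable_fun [set: plane] (f : plane -> R) ->
  (forall p, `|f p| <= B) -> L2_torus f.
Proof.
move=> mf fB; have mt := @torus_measurable R.
have mfr : measurable_fun [set: plane] (f \_ torus : plane -> R).
  by apply/(measurable_restrict _ mt measurableT); rewrite setTI; exact: measurable_funTS.
rewrite /L2_torus inE/=; apply/andP; split; rewrite inE//=.
rewrite /finite_norm unlock poweR_lty//.
have B0 : 0 <= B by apply: le_trans (fB (0, 0)).
pose h p : R := `|f p| `^ 2.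
have mh : measurable_fun [set: plane] (h : plane -> R).
  by apply: (measurableT_comp (measurable_powR 2)); exact: measurableT_comp.
have ih : torus_integrable h.
  apply: (@torus_integrable_bounded _ h (B `^ 2)) => // p _; rewrite /h ger0_norm ?powR_ge0//.
  by rewrite ge0_ler_powR// nnegrE.
apply: integrable_lty => //.
have h2 : leb2.-integrable [set: plane] ((EFin \o h) \_ torus) by rewrite -integrable_mkcond.
apply: eq_integrable h2 => // p _; rewrite /= /patch; case: ifPn => // _.
by rewrite normr0 powR0.
Qed.

(** Cauchy-Schwarz against the constant 1, which is square integrable on the torus. *)
Lemma L2_torus_integrable (v : R * R -> R) : L2_torus v -> torus_integrable v.
Proof.
move=> Lv; have mt := @torus_measurable R.
have L1 : ((fun=> 1 : R) : R * R -> R) \_ torus \in Lfun leb2 2%:E.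
  apply: (@L2_torus_bounded (fun=> 1) 1); first exact: measurable_cst.
  by move=> p; rewrite normr1.
have := Lfun2_mul_Lfun1 Lv L1 => /Lfun1_integrable.
move=> h; rewrite /torus_integrable integrable_mkcond//; apply: eq_integrable h => // p _.
by rewrite /= /patch; case: ifPn => _; rewrite ?mulr1 ?mulr0.
Qed.

Lemma turn0 : turn 0 = 1 :> R[i].
Proof. by rewrite /turn mulr0 expi0. Qed.

(** A polynomial in one coordinate, and hence its derivative, only has frequencies on the axis of
    that coordinate, where the modes agree. *)
Lemma trig_poly_low d n (f : R -> R) (v u : R * R -> R) : torus_integrable v ->
    torus_integrable u -> trig_poly n f ->
  (forall k : int, `|k| <= n%:Z -> fourier_mode v (freq_at d k 0) =
      fourier_mode u (freq_at d k 0)) ->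
  exists s, (fun p => f (axis_coord d p)) =
      mode_sum s /\ torus_inner v (mode_sum (modes_deriv d s)) =
      torus_inner u (mode_sum (modes_deriv d s)).
Proof.
move=> iv iu /trig_polyE[P [sP fP]] low.
exists [seq (P`_(nat_of_ord j), freq_at d (j%:Z - n%:Z) 0) | j <- index_enum 'I_(n.*2.+1)]; split.
  apply/funext => p; rewrite /mode_sum big_map.
  rewrite -[LHS]/(complex.Re (f (axis_coord d p))%:C) fP Re_sum; apply: eq_bigr => j _.
  by rewrite /mode_fun /= waveE; case: d {low}; rewrite /= mul0r turn0 ?mulr1 ?mul1r.
rewrite !torus_inner_mode_sum// /modes_deriv !big_map; congr complex.Re; apply: eq_bigr => j _ /=.
by rewrite low// ler_norml; have := ltn_ord j; lia.
Qed.

Lemma mode_sum_mul (s s' : seq (@mode R)) (f : R * R -> R) :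
  (forall q, exists s1, forall p, f p * mode_fun q p = mode_sum s1 p) ->
  exists s1, (fun p => f p * mode_sum s p) = mode_sum s1.
Proof.
move=> h; elim: s => [|q s [s1 IH]].
  by exists [::]; apply/funext => p; rewrite mode_sum_nil mulr0.
have [s2 h2] := h q; exists (s2 ++ s1); apply/funext => p.
by rewrite mode_sum_cons mulrDr h2 mode_sum_cat -IH.
Qed.

Lemma mode_fun_prod (q q' : @mode R) : exists s1, forall p, mode_fun q p * mode_fun q' p =
    mode_sum s1 p.
Proof.
case: q q' => c [k l] [c' [k' l']].
(* Re a * Re b is half the sum of Re (a b) and Re (a conj b). *)
exists [:: ((1 / 2)%:C * c * c', (k + k', l + l')); ((1 / 2)%:C * c * c'^*%C, (k - k', l - l'))].
move=> p; rewrite !mode_sum_cons mode_sum_nil addr0 /mode_fun /= !waveE !turn_int.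
have cj m t : turn ((- m)%:~R * t) = (turn (m%:~R * t))^*%C :> R[i].
  by rewrite conjc_turn; congr turn; rewrite rmorphN mulNr.
rewrite !cj.
move: (turn (k%:~R * p.1)) (turn (l%:~R * p.2)) (turn (k'%:~R * p.1)) (turn (l'%:~R * p.2)).
case: c c' => c1 c2 [c3 c4] [a1 a2] [b1 b2] [a3 a4] [b3 b4].
by simpc; rewrite /=; field.
Qed.

Lemma mode_sum_prod (s s' : seq (@mode R)) : exists s1,
    (fun p => mode_sum s p * mode_sum s' p) = mode_sum s1.
Proof.
apply: mode_sum_mul => // q.
have [s1 h] : exists s1, (fun p => mode_fun q p * mode_sum s p) = mode_sum s1.
  by apply: mode_sum_mul => // q'; exact: mode_fun_prod.
by exists s1 => p; rewrite -h mulrC.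
Qed.

Lemma TV_mode_sum_ge (v : R * R -> R) s1 s2 : torus_integrable v -> (forall p,
    `|mode_sum s1 p| <= 1) ->
  (forall p, `|mode_sum s2 p| <= 1) ->
      ((torus_inner v (mode_sum (modes_deriv true s1)) + torus_inner v (mode_sum (modes_deriv
      false s2)))%:E <= TV v)%E.
Proof.
move=> iv h1 h2; apply: ereal_sup_ubound.
exists (fun p => (mode_sum s1 p, mode_sum s2 p)).
  split; [exact: mode_sum_smooth|exact: mode_sum_smooth|move=> p /=; by rewrite ge_max h1 h2].
transitivity (\int[leb2]_(p in torus) (v p * mode_sum (modes_deriv true s1) p + v p * mode_sum
    (modes_deriv false s2) p)%:E)%E.
  apply: eq_integral => p _; rewrite /divergence -mulrDr.
  by rewrite -(axis_partial_mode_sum true) -(axis_partial_mode_sum false).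
have i1 := torus_integrable_mode_sum (modes_deriv true s1) iv; have i2 :=
    torus_integrable_mode_sum (modes_deriv false s2) iv.
have mt := @torus_measurable R.
rewrite /torus_inner -(RintegralD mt i1 i2) /Rintegral fineK//.
by apply: integrable_fin_num => //; exact: torus_integrableD.
Qed.

Lemma TV_ge0 (v : R * R -> R) : torus_integrable v -> (0 <= TV v)%E.
Proof.
move=> iv; have h0 p : `|mode_sum [::] p| <= 1 :> R by rewrite mode_sum_nil normr0.
have := TV_mode_sum_ge iv h0 h0; apply: le_trans; rewrite /= /torus_inner mode_sum_nil.
under eq_Rintegral do rewrite mulr0.
by rewrite Rintegral_cst ?mul0r ?addr0//; exact: torus_measurable.
Qed.

(** The bound reduces to |g| + (1 - |g|)(1 + |g|)/2 <= 1, which holds because (1 + |g|)/2 <= 1. *)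
Lemma perturb_le1 (g q : R) (e : R) : `|g| <= 1 -> `|e * q| <= 1 / 2 ->
  `|g + e * ((1 - g ^+ 2) * q)| <= 1.
Proof.
move=> g1 eq; apply: le_trans (ler_normD _ _) _.
rewrite mulrCA normrM.
have h : 0 <= 1 - g ^+ 2 by rewrite subr_ge0 -(ger0_norm (sqr_ge0 g)) normrX exprn_ile1.
rewrite (ger0_norm h).
move: eq; move: (`|e * q|) => r rr.
have : (1 - g ^+ 2) * r <= (1 - g ^+ 2) * (1 / 2) by apply: ler_wpM2l.
have -> : g ^+ 2 = `|g| ^+ 2 by rewrite real_normK// num_real.
move: (`|g|) (normr_ge0 g) g1 => a a0 a1; nra.
Qed.

(* [g + e (1 - g ^ 2) q] remains an admissible test function for small [e] of
   either sign. *)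
Lemma TV_stationary d (v : R * R -> R) (g : R -> R) (a : R) s1 U : torus_integrable v ->
  (fun p => g (axis_coord d p)) = mode_sum s1 -> (forall t, `|g t| <= 1) ->
  (forall s, (forall p, `|mode_sum s p| <= 1) ->
      ((torus_inner v (mode_sum (modes_deriv d s)) + a)%:E <= TV v)%E) ->
  torus_inner v (mode_sum (modes_deriv d s1)) + a = U -> (TV v <= U%:E)%E ->
  forall s, torus_inner v (axis_partial d (fun p => (1 - g (axis_coord d p) ^+ 2) * mode_sum s
      p)) = 0.
Proof.
move=> iv gs1 g1 TVge eU TVU s.
have [s3 h3] := mode_sum_prod s1 s1.
have [s4 h4] := mode_sum_prod ((1, (0, 0)) :: map (mode_scale (-1)) s3) s.
have w4 : (fun p => (1 - g (axis_coord d p) ^+ 2) * mode_sum s p) = mode_sum s4.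
  rewrite -h4; apply/funext => p; rewrite mode_sum_cons mode_sum_scale -h3 -gs1 mulN1r expr2.
  congr ((_ - _) * _); rewrite mode_funE /= mul1r mul0r subr0.
  by rewrite /phase mul0r mul0r addr0 mulr0 cos0.
rewrite w4 axis_partial_mode_sum.
have [B hB] := mode_sum_bounded s.
have B0 : 0 <= B by apply: le_trans (hB (0, 0)).
(* The perturbed function is admissible, so its pairing cannot exceed [TV v], hence not [U]. As the
   pairing is linear in [e], the first-order term is nonpositive. *)
have step e : `|e| * B <= 1 / 2 -> e * torus_inner v (mode_sum (modes_deriv d s4)) <= 0.
  move=> eB.
  have h1 p : `|mode_sum (s1 ++ map (mode_scale e) s4) p| <= 1.
    rewrite mode_sum_cat mode_sum_scale -gs1 -w4; apply: perturb_le1 => //.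
    by rewrite normrM; apply: le_trans eB; apply: ler_wpM2l.
  have := le_trans (TVge _ h1) TVU; rewrite lee_fin -eU lerD2r.
  have -> : torus_inner v (mode_sum (modes_deriv d (s1 ++ map (mode_scale e) s4))) =
      torus_inner v (mode_sum (modes_deriv d s1)) + e * torus_inner v (mode_sum (modes_deriv d s4)).
    rewrite !torus_inner_mode_sum// /modes_deriv map_cat big_cat raddfD /=; congr (_ + _).
    rewrite -map_comp !big_map !Re_sum mulr_sumr; apply: eq_bigr => q _ /=.
    move: (fourier_mode _ _) (2 * pi * _) => -[c1 c2] r.
    by case: q => [[a1 a2] k] /=; simpc; rewrite /=; ring.
  by rewrite gerDl.
(* [B + 1] replaces [B], which may be 0; using [step] with both signs forces the first-order term to
   vanish. *)
have eps0 : 0 < (2 * (B + 1))^-1 by rewrite invr_gt0; lra.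
have epsB : (2 * (B + 1))^-1 * B <= 1 / 2.
  by rewrite mulrC ler_pdivrMr; lra.
have := step (2 * (B + 1))^-1; have := step (- (2 * (B + 1))^-1).
rewrite normrN ger0_norm ?(ltW eps0)// => /(_ epsB) + /(_ epsB).
rewrite mulNr oppr_le0 => h1 h2.
apply/eqP; have /eqP := le_anti (introT andP (conj h2 h1)).
by rewrite mulf_eq0 gt_eqF.
Qed.

Lemma fourier_coefE (v : R * R -> R) k l : fourier_coef v (- k, - l) = fourier_mode v (k, l).
Proof.
have e p : - (2 * pi * (p.1 * (- k)%:~R + p.2 * (- l)%:~R)) = phase (k, l) p :> R.
  by rewrite /phase !rmorphN /=; ring.
rewrite /fourier_coef /Cintegral /fourier_mode /torus_inner; congr (_ +i* _);
    apply: eq_Rintegral => p _ /=;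
  by rewrite e /expi; simpc; rewrite /= mulrC.
Qed.

Lemma fourier_trunc_mode Phi (v u : R * R -> R) : fourier_trunc Phi v = fourier_trunc Phi u ->
  forall k l : int, `|k| <= Phi%:Z -> `|l| <= Phi%:Z -> fourier_mode v (k, l) =
      fourier_mode u (k, l).
Proof.
move=> e k l hk hl; rewrite -!fourier_coefE.
have h : Num.max `|(- k, - l).1| `|(- k, - l).2| <= Phi%:Z by rewrite /= ge_max !normrN hk hl.
by have := congr1 (fun F => F (exist _ (- k, - l) h)) e.
Qed.

Lemma fourier_mode_unique (v u : R * R -> R) : torus_integrable v -> torus_integrable u ->
    (forall k, fourier_mode v k = fourier_mode u k) ->
  {ae leb2, forall p, torus p -> v p = u p}.
Proof.
move=> iv iu e; have mt := @torus_measurable R.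
have ir : torus_integrable (fun p => v p + (-1) * u p) by apply: torus_integrableD => //;
    exact: torus_integrableZ.
have : forall s, torus_inner (fun p => v p + (-1) * u p) (mode_sum s) = 0.
  move=> s; rewrite /torus_inner.
  have i1 := torus_integrable_mode_sum s iv; have i2 := torus_integrable_mode_sum s iu.
  rewrite (_ : (fun p => _) = (fun p => v p * mode_sum s p - u p * mode_sum s p)); last first.
    by apply/funext => p; rewrite mulN1r mulrBl.
  rewrite (RintegralB mt i1 i2) -/(torus_inner v (mode_sum s)) -/(torus_inner u (mode_sum s))
      !torus_inner_mode_sum//.
  by under eq_bigr do rewrite e; rewrite subrr.
move=> /(fourier_complete ir); apply: (@filterS _ _ (ae_filter_ringOfSetsType leb2)) => p h pT.
by apply/eqP; rewrite -subr_eq0 -mulN1r h.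
Qed.

Lemma div_integral (v : R * R -> R) (phi : R * R -> R * R) :
  torus_integrable (fun p => v p * partial_x (fst \o phi) p) ->
  torus_integrable (fun p => v p * partial_y (snd \o phi) p) ->
  (\int[leb2]_(p in torus) (v p * divergence phi p)%:E)%E =
  (torus_inner v (partial_x (fst \o phi)) + torus_inner v (partial_y (snd \o phi)))%:E.
Proof.
move=> i1 i2; have mt := @torus_measurable R.
rewrite /torus_inner -(RintegralD mt i1 i2) /Rintegral fineK; last first.
  by apply: integrable_fin_num => //; exact: torus_integrableD.
by apply: eq_integral => p _; rewrite /divergence mulrDr.
Qed.

Lemma trig_poly_sq n (g : R -> R) : trig_poly n g -> trig_poly (n + n) (fun t => 1 - g t ^+ 2).
Proof.
move=> lg; rewrite (_ : (fun t => _) = (fun t => 1 + (-1) * (g t * g t))).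
  by apply: trig_polyD; [exact: trig_poly_const|apply: trig_polyZ; exact: trig_polyM].
by apply/funext => t; rewrite mulN1r expr2.
Qed.

Lemma one_sub_sqr_neq0 (a : R) : `|a| < 1 -> 1 - a ^+ 2 != 0.
Proof.
move=> a1; apply: lt0r_neq0; rewrite subr_gt0 -real_normK ?num_real// expr2.
have := normr_ge0 a; move: a1; move: (`|a|) => b; nra.
Qed.

(** * The image as a grid function along either axis *)

Section ImageFun.
Variables (M N : nat) (x : 'I_M.+1 -> R) (y : 'I_N.+1 -> R) (c : 'M[R]_(M.+1, N.+1)).

Lemma image_fun_x : image_fun x y c = grid_fun true x y c.
Proof.
apply/funext => p; apply: eq_bigr => m _; apply: eq_bigr => n _; congr (_ * _).
rewrite !indicE -natrM mulnb; congr (_%:R); congr nat_of_bool.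
by apply/idP/andP; rewrite !inE.
Qed.

Lemma image_fun_y : image_fun x y c = grid_fun false y x c^T.
Proof.
rewrite image_fun_x; apply/funext => p; rewrite /grid_fun exchange_big /=.
apply: eq_bigr => n _; apply: eq_bigr => m _; rewrite mxE; congr (_ * _).
by rewrite mulrC.
Qed.

Hypothesis x01 : forall m, 0 <= x m < 1.
Hypothesis y01 : forall n, 0 <= y n < 1.

Lemma image_fun_L2 : L2_torus (image_fun x y c).
Proof.
apply: (@L2_torus_bounded _ (\sum_(m < M.+1) \sum_(n < N.+1) `|c m n|)).
  apply: measurable_sum => m; apply: measurable_sum => n.
  apply: measurable_funM; first exact: measurable_cst.
  have [mA _] := cyclic_itv_measurable (x01 m) (x01 (ordS m)).
  have [mB _] := cyclic_itv_measurable (y01 n) (y01 (ordS n)).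
  by apply: measurable_indic; exact: measurableX.
move=> p; apply: le_trans (ler_norm_sum _ _ _) _; apply: ler_sum => m _.
apply: le_trans (ler_norm_sum _ _ _) _; apply: ler_sum => n _.
by rewrite normrM ler_piMr// indicE; case: (_ \in _); rewrite /= ?normr1 ?normr0.
Qed.

(** The maximum norm constrains the two components of a test field separately, so each direction is
    bounded by its own variation. *)
Lemma TV_image_le : (TV (image_fun x y c) <= (grid_variation y c + grid_variation x c^T)%:E)%E.
Proof.
apply: ge_ereal_sup => _ [phi [s1 s2 b] <-].
have b1 p : `|(fst \o phi) p| <= 1 by have := b p; rewrite ge_max => /andP[].
have b2 p : `|(snd \o phi) p| <= 1 by have := b p; rewrite ge_max => /andP[].
have [_ c1] := smooth_axis_partial true s1; have [_ c2] := smooth_axis_partial false s2.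
have [i1 _] := @integral_grid_fun R true M N x y c x01 y01 _ c1.
have [i2 _] := @integral_grid_fun R false N M y x c^T y01 x01 _ c2.
rewrite -image_fun_x in i1; rewrite -image_fun_y in i2.
rewrite (div_integral i1 i2) lee_fin lerD//.
  by rewrite image_fun_x; exact: (@grid_fun_partial_le R true).
by rewrite image_fun_y; exact: (@grid_fun_partial_le R false).
Qed.

End ImageFun.

End Duality.

(** * Optimality and uniqueness of the image *)

Lemma norm_int_le (a b : nat) (k : int) : (a <= b)%N -> `|k| <= a%:Z -> `|k| <= b%:Z.
Proof. by move=> ab ka; apply: le_trans ka _; rewrite lez_nat. Qed.

Theorem theorem2 (R : realType) :
  exists C : R, 0 < C /\
    forall (Phi : nat), (1 <= Phi)%N ->
    forall (M N : nat) (x : 'I_M.+1 -> R) (y : 'I_N.+1 -> R)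
           (c : 'M[R]_(M.+1, N.+1)),
    (forall m, 0 <= x m < 1) ->
    (forall n, 0 <= y n < 1) ->
    (forall m m' : 'I_M.+1, (m < m')%N -> x m < x m') ->
    (forall n n' : 'I_N.+1, (n < n')%N -> y n < y n') ->
    consistent_gradient_direction x y (image_fun x y c) ->
    C / Phi%:R < min_edge_dist x y ->
    unique_L2_minimizer (J0 (fourier_trunc Phi (image_fun x y c)))
                        (image_fun x y c).
Proof.
exists 144; split => // Phi Phi0 M N x y c hx hy xinc yinc [[nux [dnx sx]] [nuy [dny sy]]] gap.
have d0 : 0 < 144 / Phi%:R :> R by rewrite divr_gt0// ltr0n.
have [gx gy] : 144 / Phi%:R < min_gap x /\ 144 / Phi%:R < min_gap y.
  by move: gap; rewrite /min_edge_dist lt_min => /andP.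
have M0 : (0 < M)%N by exact: (gap_n0 gx d0).
have N0 : (0 < N)%N by exact: (gap_n0 gy d0).
set u := image_fun x y c.
have inc_inj n (z : 'I_n.+1 -> R) : (forall m m' : 'I_n.+1, (m < m')%N -> z m < z m') ->
    injective z.
  move=> zinc m m' e; have [lt|gt|/val_inj//] := ltngtP m m'.
    by have := zinc _ _ lt; rewrite e ltxx.
  by have := zinc _ _ gt; rewrite e ltxx.
have [sg1 sq1 j1] := @jump_sign R true M N x y c hx hy (inc_inj _ _ xinc) yinc N0 nux
  ltac:(rewrite -image_fun_x; exact: dnx) sx.
have [sg2 sq2 j2] := @jump_sign R false N M y x c^T hy hx (inc_inj _ _ yinc) xinc M0 nuy
  ltac:(rewrite -image_fun_y; exact: dny) sy.
have [|g1 [[n1 lg1 hn1] g1b g1x [t1 ht1]]] :=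
  @certificate R Phi M x (fun m => - sg1 m) Phi0 hx xinc gx; first by move=> m; rewrite sqrrN.
have [|g2 [[n2 lg2 hn2] g2b g2y [t2 ht2]]] :=
  @certificate R Phi N y (fun m => - sg2 m) Phi0 hy yinc gy; first by move=> m; rewrite sqrrN.
have hn1' : (n1 <= Phi)%N by apply: leq_trans hn1; rewrite -addnn leq_addr.
have hn2' : (n2 <= Phi)%N by apply: leq_trans hn2; rewrite -addnn leq_addr.
have p0 : `|0 : int| <= Phi%:Z by rewrite normr0.
have Lu : L2_torus u by exact: image_fun_L2.
have iu := L2_torus_integrable Lu.
have TVu : (TV u <= (grid_variation y c + grid_variation x c^T)%:E)%E by exact: TV_image_le.
(* The divergence of the certificate only sees frequencies that the data fix, so [v] pairs with it
   as [u] does, and for [u] this pairing attains the full variation. *)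
have dual v : torus_integrable v -> fourier_trunc Phi v = fourier_trunc Phi u ->
  exists s1 s2, [/\ (fun p => g1 p.1) = mode_sum s1, (fun p => g2 p.2) = mode_sum s2 &
    torus_inner v (mode_sum (modes_deriv true s1)) + torus_inner v (mode_sum (modes_deriv false
        s2)) = grid_variation y c + grid_variation x c^T].
  move=> iv /fourier_trunc_mode low.
  have [s1 [e1 d1]] := @trig_poly_low _ true _ _ v u iv iu lg1 (fun k hk => low k 0 (norm_int_le
      hn1' hk) p0).
  have [s2 [e2 d2]] := @trig_poly_low _ false _ _ v u iv iu lg2 (fun k hk => low 0 k p0
      (norm_int_le hn2' hk)).
  exists s1, s2; split => //; rewrite d1 d2 -(axis_partial_mode_sum true)
      -(axis_partial_mode_sum false) -e1 -e2; congr (_ + _).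
    rewrite /u image_fun_x; apply: (@grid_fun_partial_eq R true M N x y c hx hy g1 sg1) => //.
    by rewrite [X in smooth_torus X]e1; exact: mode_sum_smooth.
  rewrite /u image_fun_y; apply: (@grid_fun_partial_eq R false N M y x c^T hy hx g2 sg2) => //.
  by rewrite [X in smooth_torus X]e2; exact: mode_sum_smooth.
have TVge v : torus_integrable v -> fourier_trunc Phi v = fourier_trunc Phi u ->
    ((grid_variation y c + grid_variation x c^T)%:E <= TV v)%E.
  move=> iv ev; have [s1 [s2 [e1 e2 <-]]] := dual v iv ev.
  by apply: TV_mode_sum_ge => // p; [rewrite -e1|rewrite -e2].
have J0u : J0 (fourier_trunc Phi u) u = TV u by rewrite /J0 /convex_indicator mem_set ?adde0.
have min v : L2_torus v -> (J0 (fourier_trunc Phi u) u <= J0 (fourier_trunc Phi u) v)%E.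
  move=> Lv; have iv := L2_torus_integrable Lv; rewrite J0u /J0 /convex_indicator; case: ifPn.
    by rewrite inE /= => ev; rewrite adde0; exact: le_trans TVu (TVge v iv ev).
  (* Off the constraint the energy is infinite; [TV v] is not -oo, so the sum is +oo. *)
  by rewrite addey ?leey// -ltNye (lt_le_trans _ (TV_ge0 iv)).
split; first by split.
move=> v [Lv vmin]; have iv := L2_torus_integrable Lv.
have := vmin u Lu; rewrite J0u => Jv.
have Tlt : (TV u < +oo)%E by apply: le_lt_trans TVu _; rewrite ltry.
(* The energy of a minimizer is at most the finite [TV u], so it must satisfy the constraint. *)
have ev : fourier_trunc Phi v = fourier_trunc Phi u.
  apply/eqP/negPn/negP => /eqP ne; move: Jv; rewrite /J0 /convex_indicator memNset//.
  rewrite addey ?leye_eq; first by move=> /eqP e; rewrite e ltxx in Tlt.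
  by rewrite -ltNye (lt_le_trans _ (TV_ge0 iv)).
have TVv : (TV v <= (grid_variation y c + grid_variation x c^T)%:E)%E.
  by move: Jv; rewrite /J0 /convex_indicator mem_set//= adde0 => /le_trans; apply.
(* Used for [v] and for [u]: both attain the bound for the same certificate, hence both are
   stationary. *)
have stat w : torus_integrable w -> fourier_trunc Phi w = fourier_trunc Phi u ->
    (TV w <= (grid_variation y c + grid_variation x c^T)%:E)%E ->
    (forall s, torus_inner w (partial_x (fun p => (1 - g1 p.1 ^+ 2) * mode_sum s p)) = 0) /\
    (forall s, torus_inner w (partial_y (fun p => (1 - g2 p.2 ^+ 2) * mode_sum s p)) = 0).
  move=> iw ew TVw; have [s1 [s2 [e1 e2 eU]]] := dual w iw ew.
  have b1 p : `|mode_sum s1 p| <= 1 by rewrite -e1.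
  have b2 p : `|mode_sum s2 p| <= 1 by rewrite -e2.
  split; first by apply: (@TV_stationary _ true w g1 _ s1 _ iw e1 g1b _ eU TVw) => s hs;
      exact: TV_mode_sum_ge.
  rewrite addrC in eU; apply: (@TV_stationary _ false w g2 _ s2 _ iw e2 g2b _ eU TVw) => s hs.
  by rewrite addrC; exact: TV_mode_sum_ge.
have [vx vy] := stat v iv ev TVv; have [ux uy] := stat u iu erefl TVu.
have low := fourier_trunc_mode ev.
(* The weight 1 - g1^2 has degree at most [n1 + n1 <= Phi], so the data supply the initial modes of
   the recurrence along each of these rows. *)
have rows k l : `|l| <= Phi%:Z -> fourier_mode v (k, l) = fourier_mode u (k, l).
  move=> hl; rewrite -[(k, l)]/(freq_at true k l);
      apply: (@fourier_row_eq _ true _ _ v u l iv iu (trig_poly_sq lg1)).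
  - by exists t1; exact: one_sub_sqr_neq0.
  - by move=> s; rewrite vx ux.
  - by move=> k' hk; apply: low => //; apply: norm_int_le hk; rewrite addnn.
(* For an arbitrary first frequency [k], the rows just settled supply the initial modes of the
   recurrence in the second frequency. *)
apply: fourier_mode_unique => // -[k l]; rewrite -[(k, l)]/(freq_at false l k);
    apply: (@fourier_row_eq _ false _ _ v u k iv iu (trig_poly_sq lg2)).
- by exists t2; exact: one_sub_sqr_neq0.
- by move=> s; rewrite vy uy.
- by move=> l' hl; apply: rows; apply: norm_int_le hl; rewrite addnn.
Qed.
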